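(* Let $\lambda=(\lambda_1,\ldots,\lambda_k)$ be a partition with length $\ell(\lambda)=k\ge 2$. The complete multipartite graph $K_\lambda$ is Schur-positive if and only if either $\lambda_i\in\{1,2\}$ for all $1\le i\le \ell(\lambda)$, or $\lambda=(3,2^{\beta})$ for some integer $\beta\ge 1$.
   Context: A partition of $n$ is a weakly decreasing sequence $\lambda=(\lambda_1,\ldots,\lambda_k)$ of positive integers with sum $n$; $\ell(\lambda)=k$ is its length. Exponents denote repetition, so $(3,2^\beta)=(3,2,\ldots,2)$ with $\beta$ twos. The complete multipartite graph $K_\lambda$ is the graph whose vertex set is a disjoint union of $k$ stable (pairwise non-adjacent) sets of sizes $\lambda_1,\ldots,\lambda_k$, with every possible edge between different sets included. For a finite graph $G$ with vertices $v_1,\ldots,v_n$, the chromatic symmetric function is $X_G(\mathbf{x})=\sum_{\mathcal{C}}x_{\mathcal{C}(v_1)}\cdots x_{\mathcal{C}(v_n)}$, a formal power series over $\mathbb{Q}$ in commuting variables $x_1,x_2,\ldots$, where the sum ranges over all proper colorings $\mathcal{C}:V(G)\to\{1,2,3,\ldots\}$ (adjacent vertices get different colors). $G$ is Schur-positive if all coefficients in the expansion of $X_G$ in the basis of Schur functions $s_\mu$ are non-negative. *)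

(* Defs.v *)
From HB Require Import structures.
From mathcomp Require Import all_boot all_order all_algebra.
From mathcomp Require Import finmap monalg.

Set Implicit Arguments.
Unset Strict Implicit.
Unset Printing Implicit Defensive.

Import Order.TTheory GRing.Theory Num.Theory.

Local Open Scope ring_scope.

(* The variables x_1, x_2, ... are indexed by nat, x_(i+1) having index i, and
   a power series over Q is the function giving the coefficient of each
   (finitely supported) monomial. *)
Definition powerseries := {cmonom nat} -> rat.

Definition monomial (A : finType) (f : {ffun A -> nat}) : {cmonom nat} :=
  \big[@mmul {cmonom nat}/@mone {cmonom nat}]_(a : A) ucm (f a).

(* The formal sum of [monomial f] over all f : A -> nat satisfying P. Any f
   contributing to the coefficient of m takes its values in the support of m,
   so only these finitely many f are counted; see [genfunE]. *)
Definition genfun (A : finType) (P : pred {ffun A -> nat}) : powerseries :=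
  fun m =>
    #|[set f : {ffun A -> finsupp m} |
        let g := [ffun a => val (f a)] in P g && (monomial g == m)]|%:R.

(* For a partition: its Young diagram (rows and columns numbered from 0). *)
Definition cell (lam : seq nat) : finType :=
  {i : 'I_(size lam) & 'I_(nth 0%N lam i)}.

Definition cell_row (lam : seq nat) (u : cell lam) : nat := tag u.
Definition cell_col (lam : seq nat) (u : cell lam) : nat := tagged u.

Definition is_partition (lam : seq nat) : bool :=
  sorted geq lam && all (leq 1) lam.

Definition semistandard (mu : seq nat) (T : {ffun cell mu -> nat}) : bool :=
  [forall u, forall v,
     ((cell_row u == cell_row v) && (cell_col u < cell_col v)%N
        ==> (T u <= T v)%N)
  && ((cell_col u == cell_col v) && (cell_row u < cell_row v)%N
        ==> (T u < T v)%N)].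

Definition schur (mu : seq nat) : powerseries := genfun (@semistandard mu).

Definition schur_expansion (c : {fsfun seq nat -> rat with 0})
    (F : powerseries) : Prop :=
  (forall mu, mu \in finsupp c -> is_partition mu) /\
  (forall m, F m = \sum_(mu <- finsupp c) c mu * schur mu m).

(* Schur functions being linearly independent, such a c is unique. *)
Definition schur_positive (F : powerseries) : Prop :=
  exists c : {fsfun seq nat -> rat with 0},
    schur_expansion c F /\ forall mu, 0 <= c mu.

Definition proper_coloring (V : finType) (e : rel V) (C : {ffun V -> nat}) :
    bool :=
  [forall u, forall v, e u v ==> (C u != C v)].

Definition chromatic_sym (V : finType) (e : rel V) : powerseries :=
  genfun (proper_coloring e).

Definition graph_schur_positive (V : finType) (e : rel V) : Prop :=
  schur_positive (chromatic_sym e).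

(* The edge relation of K_lam; the stable sets are the rows of the diagram. *)
Definition multipartite (lam : seq nat) : rel (cell lam) :=
  fun u v => tag u != tag v.

Lemma multipartite_sym lam : symmetric (@multipartite lam).
Proof. by move=> u v; rewrite /multipartite eq_sym. Qed.

Lemma multipartite_irr lam : irreflexive (@multipartite lam).
Proof. by move=> u; rewrite /multipartite eqxx. Qed.

Lemma monomial_supp (A : finType) (f : {ffun A -> nat}) a :
  f a \in finsupp (monomial f).
Proof.
rewrite mem_finsupp /monomial (bigD1 a) //=.
by rewrite [X in X != _]cmM cmU eqxx.
Qed.

Lemma genfunE (A : finType) (P : pred {ffun A -> nat}) (m : {cmonom nat})
    (s : seq {ffun A -> nat}) :
    uniq s -> (forall f, (f \in s) = P f && (monomial f == m)) ->
  genfun P m = (size s)%:R.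
Proof.
move=> us sE; rewrite /genfun; congr (_%:R).
pose h (f : {ffun A -> finsupp m}) : {ffun A -> nat} := [ffun a => val (f a)].
have h_inj : injective h.
  by move=> f g /ffunP fg; apply/ffunP => a; have := fg a; rewrite !ffunE => /val_inj.
rewrite cardE -(size_map h); apply/perm_size/uniq_perm => //.
  by rewrite map_inj_uniq ?enum_uniq.
move=> f; rewrite sE; apply/mapP/idP => [[g]|/andP[Pf /eqP fm]].
  by rewrite mem_enum inE => ? ->.
have fs a : f a \in finsupp m by rewrite -fm monomial_supp.
have fE : f = h [ffun a => [` fs a]%fset].
  by apply/ffunP => a; rewrite !ffunE.
by exists [ffun a => [` fs a]%fset] => //; rewrite mem_enum inE -/(h _) -fE Pf fm eqxx.
Qed.

(* Main.v *)
Require Import Defs.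
From mathcomp Require Import all_boot all_order all_algebra.
From mathcomp Require Import finmap monalg zify ring lra.

(** A proper coloring of [K_lam] never uses a color in two different parts.

    Only if: moving the last 0 of the first row to 1 injects the semistandard
    tableaux of content (p, q, ...) with p > q into those of content
    (p - 1, q + 1, ...). Hence, as the chromatic function is symmetric, if
    [K_lam] is Schur-positive and has a proper coloring with color classes of
    sizes p > q, then it also has one with sizes p - 1 and q + 1. Starting from
    the coloring by parts, such moves reach colorings that have too few classes
    of a given size, unless [lam] is in the list or [lam = (4, 3)]. In this last
    case the coefficient at (2, 3, 2) would be at least the one at (3, 3, 1),
    but these are 6 and 8.

    If: a tableau with columns of heights p, q, u is a word recording, for each
    color, the columns that contain it, subject to a ballot condition. At a
    monomial with [j] squares and [N] linear factors the two-column Schur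
    functions have as coefficients those of (1 - X) X^j (1 + X)^N, and the
    expansion of the chromatic function becomes an identity between
    differences of factorials. *)

Set Implicit Arguments.
Unset Strict Implicit.
Unset Printing Implicit Defensive.

Import Order.TTheory GRing.Theory Num.Theory.

Local Open Scope nat_scope.

(** * Tableaux and colorings as lists of rows *)

(** Apart from [(4, 3)], the first direction uses only which coefficients are nonzero. The
    obstruction is a weight: each color class counts 1, and 1 more if its size is critical. A part
    is filled by one class of its own size or by at least two classes, so the classes weigh at least
    as much as the parts, until a move breaks this. For [(4, 3)] the moves that settle larger pairs
    still end in a colorable content, hence the exact count.

    In the other direction the coefficients are forced. Two-column Schur functions vanish at
    monomials with a cube, and at a monomial with one cube the count for [(3, 2^a)] is that for
    [(2^a)]; this fixes the coefficients of [s_(3, 2^q, 1^(2a-2q))]. The two-column coefficients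
    must then cancel what these contribute at cube-free monomials, partly with negative sign, and
    their non-negativity is the delicate point. The differences of factorials count permutations in
    which prescribed points are not fixed, which explains their sign; the proof takes it from a
    recurrence of derangement type. *)

Definition content_monomial (ms : seq nat) : {cmonom nat} :=
  \big[@mmul {cmonom nat}/@mone {cmonom nat}]_(c <- ms) ucm c.

Lemma content_monomialE ms c : content_monomial ms c = count_mem c ms.
Proof.
rewrite /content_monomial; elim: ms => [|d ms IH]; first by rewrite big_nil cm1.
by rewrite big_cons cmM IH cmU.
Qed.

Lemma eq_content_monomial ms ms' :
  (content_monomial ms == content_monomial ms') = perm_eq ms ms'.
Proof.
apply/cmP/idP => [E|/permP E] => [|c]; last by rewrite !content_monomialE E.
by apply/allP => c _ /=; rewrite -!content_monomialE E.
Qed.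

Lemma content_monomial_surj m : exists ms, m = content_monomial ms.
Proof.
exists (flatten [seq nseq (m c) c | c <- finsupp m]).
apply/eqP/cmP => c; rewrite content_monomialE count_flatten -map_comp sumnE big_map.
have [cm|cm] := boolP (c \in finsupp m); last first.
  rewrite fsfun_dflt // big_seq big1 // => d dm /=; rewrite count_nseq /=.
  by case: eqP cm dm => [->/negP|].
rewrite (bigD1_seq c) ?fset_uniq //= count_nseq /= eqxx mul1n big1 ?addn0 // => d.
by rewrite count_nseq /= => /negPf ->.
Qed.

Lemma monomial_content (A : finType) (f : {ffun A -> nat}) :
  monomial f = content_monomial (codom f).
Proof. by rewrite /content_monomial big_map big_enum. Qed.

(** The bridge from the formal sums to enumeration: colorings and tableaux are counted through codes
    [w], decoded by [dec]. *)
Lemma genfun_size (A : finType) (P : pred {ffun A -> nat}) ms (W : eqType)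
    (s : seq W) (dec : W -> {ffun A -> nat}) :
  uniq s -> {in s &, injective dec} ->
  (forall w, w \in s -> P (dec w) && perm_eq (codom (dec w)) ms) ->
  (forall f, P f -> perm_eq (codom f) ms -> exists2 w, w \in s & f = dec w) ->
  genfun P (content_monomial ms) = (size s)%:R%R.
Proof.
move=> us inj sound complete; rewrite -(size_map dec); apply: genfunE.
  by rewrite map_inj_in_uniq.
move=> f; rewrite monomial_content eq_content_monomial.
apply/mapP/andP => [[w ws ->]|[Pf fm]]; last exact: complete.
exact/andP/sound.
Qed.

Section Rows.
Variable lam : seq nat.

(** Extended by 0 outside the diagram, so that rows and columns are indexed by plain numbers instead
    of dependent ordinals. *)
Definition entry (f : {ffun cell lam -> nat}) (i j : nat) : nat :=
  if (insub i : option 'I_(size lam)) is Some i' then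
    if (insub j : option 'I_(nth 0 lam i')) is Some j' then
      f (Tagged (fun i : 'I_(size lam) => 'I_(nth 0 lam i)) j')
    else 0
  else 0.

Lemma entryE f (u : cell lam) : entry f (cell_row u) (cell_col u) = f u.
Proof. by case: u => i j; rewrite /entry /cell_row /cell_col /= !valK. Qed.

Lemma cell_row_lt (u : cell lam) : cell_row u < size lam.
Proof. exact: ltn_ord. Qed.

Lemma cell_col_lt (u : cell lam) : cell_col u < nth 0 lam (cell_row u).
Proof. exact: ltn_ord. Qed.

Lemma cellP i j : i < size lam -> j < nth 0 lam i ->
  exists2 u : cell lam, cell_row u = i & cell_col u = j.
Proof.
move=> ilt jlt.
by exists (Tagged (fun i : 'I_(size lam) => 'I_(nth 0 lam i))
             (Ordinal jlt : 'I_(nth 0 lam (Ordinal ilt)))).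
Qed.

Lemma cell_inj (u v : cell lam) :
  cell_row u = cell_row v -> cell_col u = cell_col v -> u = v.
Proof.
case: u v => [i j] [i' j'] /=; rewrite /cell_row /cell_col /= => /val_inj ii.
by case: i' / ii j' => j' /val_inj ->.
Qed.

Lemma codom_entry (f : {ffun cell lam -> nat}) :
  codom f = flatten (mkseq (fun i => mkseq (entry f i) (nth 0 lam i)) (size lam)).
Proof.
rewrite /codom /image_mem /mkseq [in LHS]enumT unlock /= /tag_enum.
rewrite map_flatten -map_comp -(val_enum_ord (size lam)) -[in RHS]map_comp -enumT.
congr flatten; apply: eq_map => i /=.
rewrite -(val_enum_ord (nth 0 lam i)) -enumT -!map_comp; apply: eq_map => j /=.
by rewrite -entryE.
Qed.

Definition of_rows (w : seq (seq nat)) : {ffun cell lam -> nat} :=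
  [ffun u => nth 0 (nth [::] w (cell_row u)) (cell_col u)].

Definition rows (f : {ffun cell lam -> nat}) : seq (seq nat) :=
  mkseq (fun i => mkseq (entry f i) (nth 0 lam i)) (size lam).

Lemma rowsK f : of_rows (rows f) = f.
Proof.
apply/ffunP => u; rewrite ffunE nth_mkseq ?cell_row_lt // nth_mkseq ?cell_col_lt //.
exact: entryE.
Qed.

Lemma shape_rows f : shape (rows f) = lam.
Proof.
apply: (@eq_from_nth _ 0); rewrite size_map size_mkseq // => i ilt.
by rewrite (nth_map [::]) ?size_mkseq // nth_mkseq // size_mkseq.
Qed.

Lemma of_rowsK w : shape w = lam -> rows (of_rows w) = w.
Proof.
move=> wlam; have sw : size w = size lam by rewrite -wlam size_map.
apply: (@eq_from_nth _ [::]); rewrite size_mkseq // => i ilt.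
have si : size (nth [::] w i) = nth 0 lam i.
  by rewrite -wlam (nth_map [::]) ?sw.
rewrite nth_mkseq //; apply: (@eq_from_nth _ 0); rewrite size_mkseq // => j jlt.
rewrite nth_mkseq //; have [u <- <-] := cellP ilt jlt.
by rewrite entryE ffunE.
Qed.

End Rows.

Definition disjoint_rows (w : seq (seq nat)) : bool :=
  pairwise (fun r r' : seq nat => ~~ has (mem r) r') w.

Lemma proper_rows lam f :
  proper_coloring (@multipartite lam) f = disjoint_rows (rows f).
Proof.
apply/'forall_forallP/(pairwiseP [::]) => [pf i i'|pw u v].
  rewrite !inE size_mkseq => ilt i'lt ii'; rewrite !nth_mkseq //.
  apply/hasPn => c /mapP[j']; rewrite mem_iota /= add0n => j'lt ->.
  apply/mapP => -[j]; rewrite mem_iota /= add0n => jlt.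
  have [u ui uj] := cellP ilt jlt; have [v vi vj] := cellP i'lt j'lt.
  rewrite -ui -uj -vi -vj !entryE => E.
  have /implyP := pf u v; rewrite -E eqxx /multipartite => H.
  suff: false by []; apply: H; apply/eqP => uv.
  by move: ii'; rewrite -ui -vi /cell_row uv ltnn.
apply/implyP; rewrite /multipartite => uv; apply/eqP => fuv.
wlog: u v uv fuv / cell_row u < cell_row v.
  move=> W; case: (ltngtP (cell_row u) (cell_row v)); first exact: W.
    by apply: W; rewrite 1?eq_sym.
  by move=> /val_inj E; rewrite E eqxx in uv.
move=> ruv; have:= pw _ _ _ _ ruv; rewrite !inE size_mkseq !cell_row_lt => /(_ isT isT).
have fr (x : cell lam) : f x \in nth [::] (rows f) (cell_row x).
  rewrite nth_mkseq ?cell_row_lt // -entryE; apply: map_f.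
  by rewrite mem_iota /= add0n cell_col_lt.
by move=> /hasPn H; have /negP := H (f v) (fr v); apply; rewrite -fuv; exact: fr.
Qed.

Fixpoint words (x : nat) (s : seq nat) : seq (seq nat) :=
  if x is x'.+1 then [seq c :: r | c <- s, r <- words x' s] else [:: [::]].

Lemma mem_words x s r : (r \in words x s) = (size r == x) && all (mem s) r.
Proof.
elim: x r => [|x IH] [|c r] //=; first by apply/allpairsP => -[[]] /= ? ? [].
rewrite eqSS; apply/allpairsP/and3P => [[[d t] /= [ds tx [-> ->]]]|[rx cs rs]].
  by move: tx; rewrite IH => /andP[].
by exists (c, r); rewrite IH rx.
Qed.

Lemma uniq_words x s : uniq s -> uniq (words x s).
Proof.
move=> us; elim: x => //= x IH; apply: allpairs_uniq => //.
by move=> [a r] [b t] _ _ /= [-> ->].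
Qed.

(** A color met in one row occurs in no other, so a row takes all occurrences in [ms] of the colors
    it uses. Hence the rows can be chosen one after the other, each passing on the untouched
    colors. *)
Definition full_words x ms : seq (seq nat) :=
  [seq r <- words x (undup ms) | perm_eq r (filter (mem r) ms)].

Lemma mem_full_words x ms r :
  (r \in full_words x ms) = (size r == x) && perm_eq r (filter (mem r) ms).
Proof.
rewrite mem_filter mem_words andbC -andbA; congr (_ && _).
rewrite andbC; case: (boolP (perm_eq _ _)) => //= rm.
by apply/allP => c; rewrite (perm_mem rm) mem_filter /= mem_undup => /andP[].
Qed.

Lemma uniq_full_words x ms : uniq (full_words x ms).
Proof. by rewrite filter_uniq ?uniq_words ?undup_uniq. Qed.

Fixpoint colorings (lam : seq nat) (ms : seq nat) : seq (seq (seq nat)) :=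
  if lam is x :: lam' then
    [seq r :: w | r <- full_words x ms,
                  w <- colorings lam' (filter (predC (mem r)) ms)]
  else if ms is [::] then [:: [::]] else [::].

Lemma mem_colorings lam ms w :
  (w \in colorings lam ms) =
  [&& shape w == lam, disjoint_rows w & perm_eq (flatten w) ms].
Proof.
elim: lam ms w => [|x lam IH] ms [|r w] /=.
- by case: ms => // c ms; rewrite perm_sym; apply/esym/negP => /perm_nilP.
- by case: ms.
- by apply/allpairsPdep => -[? [? []]].
apply/allpairsPdep/idP => [[r' [w' [rx]]]|].
  rewrite IH => /and3P[/eqP <- dw pw] [-> ->]; move: rx.
  rewrite mem_full_words => /andP[/eqP -> pr].
  rewrite eqxx dw andbT /=; apply/andP; split.
    apply/allP => t tw; apply/hasPn => c ct.
    have : c \in flatten w' by apply/flattenP; exists t.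
    by rewrite (perm_mem pw) mem_filter => /andP[].
  by rewrite (permPl (perm_cat pr pw)) perm_filterC.
case/and3P=> /eqP[rx wx] /andP[/allP ad dw] pw.
have rw : filter (mem r) (flatten w) = [::].
  apply/eqP; rewrite -(negbK (_ == _)) -has_filter -all_predC.
  by apply/allP => c /flattenP[t tw ct] /=; have /hasPn/(_ c ct) := ad _ tw.
exists r, w; split=> //; last first.
  rewrite IH wx eqxx dw -(permPr (perm_filter _ pw)) filter_cat /=.
  have -> : filter (predC (mem r)) r = [::].
    apply/eqP; rewrite -(negbK (_ == _)) -has_filter -all_predC.
    by apply/allP => c /=; rewrite negbK.
  rewrite [filter _ _](_ : _ = flatten w) //; apply/all_filterP.
  by apply/allP => c /flattenP[t tw ct] /=; have /hasPn/(_ c ct) := ad _ tw.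
rewrite mem_full_words rx eqxx -(permPr (perm_filter _ pw)) filter_cat rw cats0.
by have /all_filterP -> : all (mem r) r; [apply/allP | rewrite perm_refl].
Qed.

Lemma uniq_colorings lam ms : uniq (colorings lam ms).
Proof.
elim: lam ms => [|x lam IH] [|c ms] //=; apply: allpairs_uniq_dep => //;
  rewrite ?uniq_full_words //.
- by move=> [? ?] [? ?] _ _ [-> ->].
- by move=> [? ?] [? ?] _ _ [-> ->].
Qed.

Lemma chromatic_multipartite lam ms :
  chromatic_sym (@multipartite lam) (content_monomial ms)
    = (size (colorings lam ms))%:R%R.
Proof.
apply: (@genfun_size _ _ _ _ _ (@of_rows lam)); first exact: uniq_colorings.
- move=> w w'; rewrite !mem_colorings => /andP[/eqP sw _] /andP[/eqP sw' _] E.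
  by rewrite -(of_rowsK sw) E of_rowsK.
- move=> w; rewrite mem_colorings => /and3P[/eqP sw dw pw].
  by rewrite proper_rows codom_entry -/(rows _) of_rowsK // dw.
move=> f Pf pf; exists (rows f); rewrite ?rowsK //.
by rewrite mem_colorings shape_rows eqxx -proper_rows Pf -codom_entry.
Qed.

(** * Sums over the color classes of a content *)

Definition class_sum (phi : nat -> nat) (ms : seq nat) :=
  \sum_(c <- undup ms) phi (count_mem c ms).

Lemma class_sum_perm phi ms ms' :
  perm_eq ms ms' -> class_sum phi ms = class_sum phi ms'.
Proof.
move=> pm; rewrite /class_sum (perm_big _ (perm_undup (perm_mem pm))) /=.
by apply: eq_bigr => c _; rewrite (permP pm).
Qed.

Lemma class_sum_cat phi s t : ~~ has (mem s) t ->
  class_sum phi (s ++ t) = class_sum phi s + class_sum phi t.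
Proof.
move=> /hasPn st; rewrite /class_sum undup_cat big_cat /=.
have -> : [seq x <- undup s | x \notin t] = undup s.
  apply/all_filterP/allP => c; rewrite mem_undup => cs.
  by apply/negP => /st; rewrite /= cs.
congr (_ + _); rewrite !big_seq; apply: eq_bigr => c; rewrite mem_undup => cx.
  rewrite count_cat [X in _ + X](_ : _ = 0) ?addn0 //.
  by apply/count_memPn/negP => /st; rewrite /= cx.
by rewrite count_cat (count_memPn (st _ cx)).
Qed.

Lemma class_sum_nseq phi x c : class_sum phi (nseq x.+1 c) = phi x.+1.
Proof.
have -> : class_sum phi (nseq x.+1 c) =
    \sum_(d <- [:: c]) phi (count_mem d (nseq x.+1 c)).
  apply: perm_big; apply: uniq_perm; rewrite ?undup_uniq // => d.
  by rewrite mem_undup mem_nseq inE.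
by rewrite big_seq1 count_nseq /= eqxx mul1n.
Qed.

(** * Monotonicity of the coefficients of a Schur function *)

Lemma genfun_listE (A : finType) (P : pred {ffun A -> nat}) ms :
  exists s : seq {ffun A -> nat},
    [/\ uniq s, forall f, (f \in s) = P f && perm_eq (codom f) ms
      & genfun P (content_monomial ms) = (size s)%:R%R].
Proof.
set B := (\max_(c <- ms) c).+1.
pose h (g : {ffun A -> 'I_B}) : {ffun A -> nat} := [ffun a => val (g a)].
have h_inj : injective h.
  move=> g g' /ffunP gg; apply/ffunP => a.
  by have := gg a; rewrite !ffunE => /val_inj.
pose s := [seq f <- [seq h g | g <- enum {: {ffun A -> 'I_B}}]
             | P f && perm_eq (codom f) ms].
have us : uniq s by rewrite filter_uniq // map_inj_uniq ?enum_uniq.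
have sE f : (f \in s) = P f && perm_eq (codom f) ms.
  rewrite mem_filter; apply: andb_idr => /andP[_ fm].
  have fB a : f a < B.
    rewrite ltnS; apply: (@leq_bigmax_seq _ ms xpredT id (f a)) => //.
    by rewrite -(perm_mem fm) codom_f.
  apply/mapP; exists [ffun a => Ordinal (fB a)]; rewrite ?mem_enum //.
  by apply/ffunP => a; rewrite !ffunE.
exists s; split=> //; apply: genfunE => // f.
by rewrite sE monomial_content eq_content_monomial.
Qed.

Lemma genfun_le (A : finType) (P : pred {ffun A -> nat}) ms ms'
    (h : {ffun A -> nat} -> {ffun A -> nat}) :
  (forall f, P f -> perm_eq (codom f) ms ->
     P (h f) /\ perm_eq (codom (h f)) ms') ->
  (forall f g, P f -> perm_eq (codom f) ms -> P g -> perm_eq (codom g) ms ->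
     h f = h g -> f = g) ->
  (genfun P (content_monomial ms) <= genfun P (content_monomial ms'))%R.
Proof.
move=> hP hinj.
have [s [us sE ->]] := genfun_listE P ms.
have [s' [_ sE' ->]] := genfun_listE P ms'.
rewrite ler_nat -(size_map h); apply: uniq_leq_size.
  rewrite map_inj_in_uniq // => f g; rewrite !sE => /andP[? ?] /andP[? ?].
  exact: hinj.
move=> _ /mapP[f fs ->]; rewrite sE'.
by move: fs; rewrite sE => /andP[Pf pf]; have [-> ->] := hP f Pf pf.
Qed.

Lemma sorted_nth_leq (r : seq nat) j v : sorted leq r -> j < size r ->
  (nth 0 r j <= v) = (j < count (fun c => c <= v) r).
Proof.
elim: r j => [|c r IH] //= j; rewrite (path_sortedE leq_trans) => /andP[/allP cr sr].
case: (leqP c v) => [cv|vc]; first by case: j => [|j] //=; rewrite ltnS => /(IH _ sr) ->.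
rewrite (eqP (_ : count _ _ == 0)); last first.
  rewrite -leqn0 leqNgt -has_count -all_predC; apply/allP => d /cr /= cd.
  by rewrite -ltnNge (leq_trans vc).
case: j => [|j] /= jr; first by rewrite [c <= v]leqNgt vc.
by rewrite [_ <= v]leqNgt (leq_trans vc) ?cr ?mem_nth.
Qed.

Lemma partition_nth mu i i' : is_partition mu -> i <= i' -> nth 0 mu i' <= nth 0 mu i.
Proof.
move=> /andP[smu _] ii'; have [i'lt|] := ltnP i' (size mu); last first.
  by move=> /(nth_default 0) ->.
have geq_trans : transitive geq by move=> a b c /= ab bc; exact: leq_trans bc ab.
apply: (sorted_leq_nth geq_trans _ _ smu) => //; first exact: leqnn.
by rewrite inE (leq_ltn_trans ii').
Qed.

Section Move.
Variables (mu ms : seq nat).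
Hypothesis mu_part : is_partition mu.
Hypothesis le_ms : count_mem 1 ms <= count_mem 0 ms.
Let p := count_mem 0 ms.

Implicit Types f g : {ffun cell mu -> nat}.

(* [0, p] is the cell of the last 0 when the content is [0 :: ms]. *)
Definition lower f : {ffun cell mu -> nat} :=
  [ffun u => if (cell_row u == 0) && (cell_col u == p) then 1 else f u].

Lemma semistandard_row f (u v : cell mu) : semistandard f ->
  cell_row u = cell_row v -> cell_col u <= cell_col v -> f u <= f v.
Proof.
move=> /'forall_forallP/(_ u v)/andP[/implyP H _] ruv.
rewrite leq_eqVlt => /orP[/eqP cuv|cuv]; first by rewrite (cell_inj ruv cuv).
by apply: H; rewrite ruv eqxx.
Qed.

Lemma semistandard_col f (u v : cell mu) : semistandard f ->
  cell_col u = cell_col v -> cell_row u < cell_row v -> f u < f v.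
Proof.
move=> /'forall_forallP/(_ u v)/andP[_ /implyP H] cuv ruv.
by apply: H; rewrite cuv eqxx.
Qed.

Lemma cell_above (u : cell mu) i : i <= cell_row u ->
  exists2 v : cell mu, cell_row v = i & cell_col v = cell_col u.
Proof.
move=> iu; apply: cellP; first exact: leq_ltn_trans iu (cell_row_lt u).
exact: leq_trans (cell_col_lt u) (partition_nth _ iu).
Qed.

Lemma sorted_row f i : semistandard f ->
  sorted leq (mkseq (entry f i) (nth 0 mu i)).
Proof.
move=> sf; have [ilt|] := ltnP i (size mu); last by move=> /(nth_default 0) ->.
apply/(sortedP 0) => j; rewrite size_mkseq => jlt.
rewrite !nth_mkseq ?(ltnW jlt) //.
have [u ur uc] := cellP ilt jlt; have [v vr vc] := cellP ilt (ltnW jlt).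
rewrite -uc -{1}vr -vc -ur !entryE; apply: semistandard_row => //.
  by rewrite vr ur.
by rewrite vc uc.
Qed.

Lemma row_le_value f u : semistandard f -> cell_row u <= f u.
Proof.
move=> sf; move ru: (cell_row u) => i; elim: i u ru => // i IH u ru.
have [|v vr vc] := @cell_above u i; first by rewrite ru.
by apply: leq_ltn_trans (IH _ vr) _; apply: semistandard_col; rewrite ?vr ?ru.
Qed.

(** The row increases weakly and [v] bounds it from below, so its entries [v] form a prefix. *)
Lemma prefix_row f i j v : semistandard f -> i < size mu -> j < nth 0 mu i ->
  (forall u, cell_row u = i -> v <= f u) ->
  (entry f i j <= v) = (j < count_mem v (mkseq (entry f i) (nth 0 mu i))).
Proof.
move=> sf ilt jlt vmin; have := @sorted_nth_leq _ j v (sorted_row i sf).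
rewrite size_mkseq nth_mkseq // => ->//; congr (_ < _).
apply: eq_in_count => c /mapP[j']; rewrite mem_iota /= add0n => j'lt ->.
have [u ur uc] := cellP ilt j'lt.
by rewrite -ur -uc entryE eqn_leq vmin // andbT.
Qed.

Lemma count_codom f v : count_mem v (codom f) =
  \sum_(i < size mu) count_mem v (mkseq (entry f i) (nth 0 mu i)).
Proof.
rewrite codom_entry count_flatten -map_comp sumnE big_map.
rewrite -(big_mkord xpredT (fun i => count_mem v (mkseq (entry f i) (nth 0 mu i)))).
by rewrite /index_iota subn0.
Qed.

Lemma zeros_row f : semistandard f -> 0 < size mu ->
  count_mem 0 (mkseq (entry f 0) (nth 0 mu 0)) = count_mem 0 (codom f).
Proof.
move=> sf mu0; rewrite count_codom (bigD1 (Ordinal mu0)) //= big1 ?addn0 // => i i0.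
apply/eqP; rewrite -leqn0 leqNgt -has_count; apply/hasPn => c /mapP[j].
rewrite mem_iota /= add0n => jlt ->; have [u ur uc] := cellP (ltn_ord i) jlt.
rewrite -ur -uc entryE; rewrite -lt0n; apply: leq_trans (row_le_value u sf).
by rewrite ur lt0n; apply: contraNneq i0 => E; apply/eqP/val_inj.
Qed.

(** Entries of row [i] are at least [i], so all [p + 1] zeros are in row 0, in columns 0 to [p]. The
    ones of row 1 form a prefix of length at most [count_mem 1 ms <= p], so nothing below the last
    zero is a 1 and it can be raised. *)
Lemma lower_corner f : semistandard f -> perm_eq (codom f) (0 :: ms) ->
  exists s : cell mu, [/\ cell_row s = 0, cell_col s = p, f s = 0,
    (forall u, cell_row u = 0 -> p < cell_col u -> 0 < f u)
  & (forall u, cell_col u = p -> 0 < cell_row u -> 1 < f u)].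
Proof.
move=> sf pf; have c0 : count_mem 0 (codom f) = p.+1.
  by rewrite (permP pf) /= add1n.
have mu0 : 0 < size mu.
  rewrite lt0n; apply/eqP => mu0; move: c0; rewrite count_codom big1 //.
  by move=> i; have := ltn_ord i; rewrite {2}mu0.
have pre j : j < nth 0 mu 0 -> (entry f 0 j <= 0) = (j < p.+1).
  by move=> jlt; rewrite (prefix_row sf) // zeros_row // c0.
have plt : p < nth 0 mu 0.
  have := count_size (pred1 0) (mkseq (entry f 0) (nth 0 mu 0)).
  by rewrite zeros_row // c0 size_mkseq.
have [s sr sc] := cellP mu0 plt.
have es : entry f 0 p = f s by rewrite -sr -sc entryE.
exists s; split=> // [|u ur uc|u uc ur].
- by have := pre _ plt; rewrite es ltnSn leqn0 => /eqP.
- have := cell_col_lt u; rewrite ur => /pre.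
  by rewrite -{1}ur entryE lt0n -leqn0 => ->; rewrite ltnS -ltnNge.
have [v vr vc] := cell_above ur.
suff v1 : 1 < f v.
  case: (ltngtP (cell_row v) (cell_row u)) => [vu|uv|vu].
  - by apply: ltn_trans v1 (semistandard_col sf vc vu).
  - by move: uv; rewrite vr ltnNge ur.
  - by rewrite -(cell_inj vu vc).
have mu1 : 1 < size mu by rewrite -vr cell_row_lt.
have vlt : cell_col v < nth 0 mu 1 by rewrite -vr cell_col_lt.
have ev : entry f 1 (cell_col v) = f v by rewrite -vr entryE.
have min1 x : cell_row x = 1 -> 1 <= f x by move=> <-; exact: row_le_value.
have := prefix_row sf mu1 vlt min1; rewrite ev => E; rewrite ltnNge E -leqNgt.
have -> : cell_col v = p by rewrite vc uc.
apply: leq_trans le_ms; have <- : count_mem 1 (codom f) = count_mem 1 ms by rewrite (permP pf).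
by rewrite count_codom (bigD1 (Ordinal mu1)) //= leq_addr.
Qed.

(** The corner has the same place in all tableaux of this content and holds 0 there; this makes
    [lower] injective. *)
Lemma schur_move :
  (schur mu (content_monomial (0 :: ms)) <= schur mu (content_monomial (1 :: ms)))%R.
Proof.
apply: (genfun_le (h := lower)) => [f sf pf|f g sf pf sg pg fg]; last first.
  have [s [sr sc fs _ _]] := lower_corner sf pf.
  have [t [tr tc gt _ _]] := lower_corner sg pg.
  apply/ffunP => u; have [->|us] := eqVneq u s.
    by rewrite fs (cell_inj (_ : cell_row s = cell_row t)) ?gt ?sr ?sc ?tr ?tc.
  move/ffunP/(_ u): fg; rewrite !ffunE; case: andP => // -[/eqP ur /eqP uc].
  by case/eqP: us; apply: cell_inj; rewrite ?ur ?uc ?sr ?sc.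
have [s [sr sc fs fr fc]] := lower_corner sf pf.
have lE u : lower f u = if u == s then 1 else f u.
  rewrite ffunE; have [->|us] := eqVneq u s; first by rewrite sr sc !eqxx.
  case: andP => // -[/eqP ur /eqP uc].
  by case/eqP: us; apply: cell_inj; rewrite ?ur ?uc ?sr ?sc.
split.
  apply/'forall_forallP => u v; apply/andP; split; apply/implyP => /andP[/eqP e lt].
    rewrite !lE; case: (eqVneq u s) => [us|_]; case: (eqVneq v s) => [vs|_] //.
    - by apply: fr; [rewrite -e us sr | rewrite -sc -us].
    - by rewrite (leq_trans (semistandard_row sf e (ltnW lt))) // vs fs.
    - exact: semistandard_row sf e (ltnW lt).
  rewrite !lE; case: (eqVneq v s) => [vs|_]; first by rewrite vs sr in lt.
  case: (eqVneq u s) => [us|_]; last exact: semistandard_col sf e lt.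
  by apply: fc; [rewrite -e us | apply: leq_ltn_trans lt].
have es := perm_to_rem (mem_enum predT s : s \in enum (cell mu) = true).
rewrite /codom /image_mem in pf *.
have := perm_map f es; have := perm_map (lower f) es.
rewrite /= lE eqxx => /permPl ->; rewrite fs => /permPl E.
move: pf; rewrite E perm_cons => pf; rewrite perm_cons.
rewrite [X in perm_eq X](_ : _ = [seq f i | i <- rem s (enum (cell mu))]) //.
apply/eq_in_map => u; rewrite mem_rem_uniq ?enum_uniq // => /andP[us _].
by rewrite lE (negPf us).
Qed.
End Move.

(** * Partitions of the Schur-positive complete multipartite graphs *)

Lemma size_colorings_move lam ms :
  graph_schur_positive (@multipartite lam) ->
  count_mem 1 ms <= count_mem 0 ms ->
  size (colorings lam (0 :: ms)) <= size (colorings lam (1 :: ms)).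
Proof.
move=> [c [[cpart cE] c0]] le_ms.
rewrite -(ler_nat rat) -!chromatic_multipartite.
rewrite !cE big_seq [leRHS]big_seq; apply: ler_sum => mu /cpart mu_part.
by apply: ler_wpM2l (schur_move mu_part le_ms); exact: c0.
Qed.

(** * Recoloring moves on contents *)

Definition colorable (lam ms : seq nat) : Prop :=
  exists w, w \in colorings lam ms.

Lemma colorable_perm lam ms ms' :
  perm_eq ms ms' -> colorable lam ms -> colorable lam ms'.
Proof.
move=> pm [w]; rewrite mem_colorings => /and3P[sw dw pw]; exists w.
by rewrite mem_colorings sw dw (perm_trans pw pm).
Qed.

Lemma colorable_map lam ms (sigma : nat -> nat) : injective sigma ->
  colorable lam ms -> colorable lam (map sigma ms).
Proof.
move=> inj [w]; rewrite mem_colorings => /and3P[/eqP sw dw pw].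
exists (map (map sigma) w); rewrite mem_colorings -map_flatten perm_map // andbT.
apply/andP; split.
  by rewrite -sw /shape -map_comp; apply/eqP/eq_map => r /=; rewrite size_map.
rewrite /disjoint_rows pairwise_map; apply: sub_pairwise dw => r t /hasPn rt.
apply/hasPn => _ /mapP[c ct ->]; apply/negP => /mapP[d dr /inj cd].
by move: (rt c ct); rewrite /= cd dr.
Qed.

Definition nat_swap (a b x : nat) := if x == a then b else if x == b then a else x.

Lemma nat_swapK a b : involutive (nat_swap a b).
Proof.
move=> x; rewrite /nat_swap; case: (eqVneq x a) => [->|xa].
  by case: (eqVneq b a) => [->|]; rewrite ?eqxx.
by case: (eqVneq x b) => [->|xb]; rewrite ?eqxx // (negPf xa) (negPf xb).
Qed.

(** Permuting the colors preserves proper colorings, so the move from color 0 to color 1 is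
    available for any two colors. *)
Lemma colorable_recolor lam i j ms s s' :
  graph_schur_positive (@multipartite lam) -> i != j ->
  count_mem j ms <= count_mem i ms -> perm_eq s (i :: ms) ->
  perm_eq (j :: ms) s' -> colorable lam s -> colorable lam s'.
Proof.
move=> sp ij le_ms sms mss' /(colorable_perm sms) col; apply: colorable_perm mss' _.
(* [sigma] sends [i] to 0 and [j] to 1; its second swap must start from [j'], the place of [j] after
   the first. *)
pose j' := nat_swap 0 i j.
pose sigma x := nat_swap 1 j' (nat_swap 0 i x).
pose tau x := nat_swap 0 i (nat_swap 1 j' x).
have sK : cancel sigma tau by move=> x; rewrite /tau /sigma !nat_swapK.
have tK : cancel tau sigma by move=> x; rewrite /tau /sigma !nat_swapK.
have si : sigma i = 0.
  rewrite /sigma (_ : nat_swap 0 i i = 0); last by rewrite /nat_swap eqxx; case: eqP.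
  rewrite /nat_swap /= /j'; case: eqP => // /esym E.
  by move: ij; rewrite -(nat_swapK 0 i j) E /nat_swap /= eqxx.
have sj : sigma j = 1.
  by rewrite /sigma -/j' /nat_swap eqxx; case: eqP.
have cnt x y : sigma x = y -> count_mem y (map sigma ms) = count_mem x ms.
  by move=> <-; rewrite count_map; apply: eq_count => z /=; rewrite (can_eq sK).
have := colorable_map (can_inj sK) col; rewrite /= si => -[w cw].
have le1 := @size_colorings_move lam (map sigma ms) sp.
have : colorable lam (1 :: map sigma ms).
  move: le1; rewrite (cnt _ _ si) (cnt _ _ sj) => /(_ le_ms).
  case: (colorings lam (0 :: _)) cw => [//|? ? _] /=.
  case E: (colorings lam (1 :: _)) => [//|w' t] _.
  by exists w'; rewrite E mem_head.
move/(colorable_map (can_inj tK)); rewrite /= -sj sK -map_comp.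
by rewrite (eq_map (g := id)) ?map_id // => x /=; rewrite sK.
Qed.

(** The factor [0 < x] gives weight 0 to a color that is not in use. *)
Definition weight (q : pred nat) (x : nat) := (0 < x) * (1 + q x).

Notation total_weight q := (class_sum (weight q)).

Lemma total_weight_nseq q x c : total_weight q (nseq x c) = weight q x.
Proof. by case: x => [|x]; rewrite ?class_sum_nseq // /class_sum big_nil. Qed.

(** A monochromatic row gives equality; two colors already weigh at least 2, the largest value of
    [weight]. *)
Lemma total_weight_row q r : 0 < size r -> weight q (size r) <= total_weight q r.
Proof.
case: r => // c r _; move: (c :: r) (mem_head c r) => s cs.
have [/all_pred1P ->|] := boolP (all (pred1 c) s).
  by rewrite total_weight_nseq size_nseq.
case/allPn => d ds /= dc.
rewrite /class_sum (bigD1_seq c) ?undup_uniq ?mem_undup //=.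
rewrite (big_rem d) ?mem_undup //= dc addnA.
apply: leq_trans (leq_addr _ _); rewrite /weight.
have -> : 0 < count_mem c s by rewrite -has_count has_pred1.
have -> : 0 < count_mem d s by rewrite -has_count has_pred1.
by rewrite !mul1n; case: (0 < size s); case: (q _); case: (q _); case: (q _).
Qed.

(* A row of a proper coloring either is monochromatic or uses two colors, and
   no color occurs in two rows. *)
Lemma colorable_weight q lam ms : all (leq 1) lam -> colorable lam ms ->
  \sum_(x <- lam) weight q x <= total_weight q ms.
Proof.
move=> lam0 [w]; rewrite mem_colorings => /and3P[/eqP sw dw pw].
rewrite -(class_sum_perm _ pw); rewrite -{}sw in lam0 *.
elim: w dw lam0 {pw} => [_ _|r w IH /= /andP[/allP rw dw] /andP[r0 w0]].
  by rewrite big_nil.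
rewrite big_cons class_sum_cat; last first.
  apply/hasPn => c /flattenP[t tw ct] /=.
  by have /hasPn/(_ c ct) := rw t tw.
by apply: leq_add; [exact: total_weight_row | exact: IH].
Qed.

(** [S x y z] means that the content is colorable when the colors of the parts [a] and [b] and a
    fresh color occur [x], [y], [z] times and every other part contributes its own color. Hiding the
    colors leaves arithmetic. The weight of the other parts stands on both sides of the bound and
    cancels. *)
Lemma recoloring_states lam a b rest :
  graph_schur_positive (@multipartite lam) -> all (leq 1) lam ->
  perm_eq lam (a :: b :: rest) ->
  exists S : nat -> nat -> nat -> Prop,
  [/\ S a b 0,
      forall x y z, y <= x -> S x.+1 y z -> S x y.+1 z,
      forall x y z, z <= x -> S x.+1 y z -> S x y z.+1,
      forall x y z, z <= y -> S x y.+1 z -> S x y z.+1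
    & forall q x y z, S x y z ->
      weight q a + weight q b <= weight q x + weight q y + weight q z].
Proof.
move=> sp lam0 plam.
have := plam; rewrite perm_sym => /(perm_iotaP 0)[[|i [|j Js]]] // pI.
move=> [ea eb er].
have /and3P[iJ jJ uJ] : uniq [:: i, j & Js] by rewrite (perm_uniq pI) iota_uniq.
move: iJ; rewrite inE negb_or => /andP[ij iJ].
pose blk l := nseq (nth 0 lam l) l.
pose R := flatten (map blk Js).
have RJ c : c \in R -> c \in Js.
  by move=> /flattenP[_ /mapP[l lJ ->]]; rewrite mem_nseq => /andP[_ /eqP ->].
pose k := (maxn i (maxn j (\max_(c <- Js) c))).+1.
have ki : i < k by rewrite ltnS leq_maxl.
have kj : j < k by rewrite ltnS (leq_trans _ (leq_maxr _ _)) ?leq_maxl.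
have kR : k \notin R.
  apply/negP => /RJ kJ; have := @leq_bigmax_seq _ Js xpredT id k kJ isT.
  by rewrite leqNgt /= ltnS /k !leq_max leqnn !orbT.
have iR : i \notin R by apply: contra iJ => /RJ.
have jR : j \notin R by apply: contra jJ => /RJ.
have wR q : total_weight q R = \sum_(x <- rest) weight q x.
  rewrite er /R big_map; elim: Js uJ {pI er iJ jJ R RJ k ki kj kR iR jR}.
    by move=> _; rewrite /class_sum !big_nil.
  move=> l Js IH /= /andP[lJ uJ]; rewrite class_sum_cat.
    by rewrite big_cons total_weight_nseq IH.
  apply/hasPn => c /flattenP[_ /mapP[l' lJ' ->]] /=; rewrite !mem_nseq.
  move=> /andP[_ /eqP ->]; apply: contra lJ => /andP[_ /eqP <-]; exact: lJ'.
have [st stE] : exists st, forall x y z,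
    st x y z = nseq x i ++ nseq y j ++ nseq z k ++ R.
  by exists (fun x y z => nseq x i ++ nseq y j ++ nseq z k ++ R).
exists (fun x y z => colorable lam (st x y z)).
have cR : [/\ count_mem i R = 0, count_mem j R = 0 & count_mem k R = 0].
  by split; apply/count_memPn.
have [cRi cRj cRk] := cR.
have ik : i != k by rewrite neq_ltn ki.
have jk : j != k by rewrite neq_ltn kj.
have [ji kI kJ] : [/\ j != i, k != i & k != j] by split; rewrite eq_sym.
have cst P x y z : count P (st x y z) = P i * x + P j * y + P k * z + count P R.
  by rewrite stE !count_cat !count_nseq; lia.
have ci x y z : count_mem i (st x y z) = x.
  by rewrite cst /= eqxx (negPf ji) (negPf kI) cRi; lia.
have cj x y z : count_mem j (st x y z) = y.
  by rewrite cst /= eqxx (negPf ij) (negPf kJ) cRj; lia.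
have ck x y z : count_mem k (st x y z) = z.
  by rewrite cst /= eqxx (negPf ik) (negPf jk) cRk; lia.
split.
- exists (mkseq blk (size lam)); rewrite mem_colorings; apply/and3P; split.
  + apply/eqP/(@eq_from_nth _ 0); rewrite size_map size_mkseq // => l llt.
    by rewrite (nth_map [::]) ?size_mkseq // nth_mkseq // size_nseq.
  + apply/(pairwiseP [::]) => l l'; rewrite !inE size_mkseq => llt llt' ll.
    rewrite !nth_mkseq //; apply/hasPn => c; rewrite !mem_nseq => /andP[_ /eqP ->].
    by rewrite /= mem_nseq (gtn_eqF ll) andbF.
  + rewrite stE /= ea eb.
    by have := perm_flatten (perm_map blk pI); rewrite perm_sym.
- move=> x y z le_yx; apply: (@colorable_recolor _ i j (st x y z)) => //.
  + by rewrite ci cj.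
  + by apply/permP => P; rewrite /= !cst; lia.
  + by apply/permP => P; rewrite /= !cst; lia.
- move=> x y z le_zx; apply: (@colorable_recolor _ i k (st x y z)) => //.
  + by rewrite ci ck.
  + by apply/permP => P; rewrite /= !cst; lia.
  + by apply/permP => P; rewrite /= !cst; lia.
- move=> x y z le_zy; apply: (@colorable_recolor _ j k (st x y z)) => //.
  + by rewrite cj ck.
  + by apply/permP => P; rewrite /= !cst; lia.
  + by apply/permP => P; rewrite /= !cst; lia.
move=> q x y z /(colorable_weight q lam0); rewrite (perm_big _ plam) stE /= !big_cons.
rewrite !class_sum_cat.
- by rewrite !total_weight_nseq wR !addnA leq_add2r.
- apply/hasPn => c cR'; rewrite /= mem_nseq; by apply: contra kR => /andP[_ /eqP <-].
- apply/hasPn => c; rewrite mem_cat /= !mem_nseq => /orP[/andP[_ /eqP ->]|cR'].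
    by rewrite (negPf kJ) andbF.
  by apply: contra jR => /andP[_ /eqP <-].
apply/hasPn => c; rewrite !mem_cat /= !mem_nseq.
case/or3P=> [/andP[_ /eqP ->]|/andP[_ /eqP ->]|cR'].
- by rewrite (negPf ji) andbF.
- by rewrite (negPf kI) andbF.
by apply: contra iR => /andP[_ /eqP <-].
Qed.

(** With class sizes 3, 1, 3 either large class fills the part 3 and the single color has four
    places in the part 4, giving 8 colorings; with sizes 2, 2, 3 only the arrangement of two pairs
    in the part 4 is free, giving 6. *)
Lemma not_schur_positive_43 : ~ graph_schur_positive (@multipartite [:: 4; 3]).
Proof.
by move=> /(@size_colorings_move _ [:: 0; 0; 1; 2; 2; 2])/(_ isT); vm_compute.
Qed.

Lemma schur_positive_parts lam : is_partition lam -> 2 <= size lam ->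
  graph_schur_positive (@multipartite lam) ->
  (forall x, x \in lam -> x = 1 \/ x = 2) \/
  (exists beta, 1 <= beta /\ lam = 3 :: nseq beta 2).
Proof.
move=> plam k2 sp; have /andP[slam lam0] := plam.
case: lam k2 plam slam lam0 sp => [|x [|y rest]] // _ plam slam lam0 sp.
have mon := partition_nth plam.
have xmax z : z \in x :: y :: rest -> 0 < z <= x.
  move=> zl; rewrite (allP lam0) // -(nth_index 0 zl).
  exact: (mon 0).
have [x2|x3] := leqP x 2.
  left=> z /xmax; lia.
(* If [z <= x - 2], one move yields classes of sizes [x - 1] and [z + 1]. Neither has the size [x],
   so they weigh 2, while the parts weigh 3. *)
have noalmost z : z \in y :: rest -> x <= z.+1.
  move=> zl; rewrite leqNgt; apply/negP => zx.
  have pz : perm_eq (x :: y :: rest) [:: x, z & rem z (y :: rest)].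
    by rewrite perm_cons perm_to_rem.
  have [S [S0 S1 _ _ W]] := recoloring_states sp lam0 pz.
  have /xmax/andP[z0 _] : z \in x :: y :: rest by rewrite in_cons zl orbT.
  have := S1 x.-1 z 0; rewrite prednK; last by lia.
  move=> /(_ _ S0) H; have {}H := H ltac:(lia).
  have := W (pred1 x) _ _ _ H; rewrite /weight /= eqxx.
  have -> : (x.-1 == x) = false by lia.
  have -> : (z.+1 == x) = false by lia.
  have -> : (z == x) = false by lia.
  lia.
(* From two parts [z >= 3], two moves to the fresh color yield sizes [z - 1], [z - 1], 2, of weight
   3 instead of 4. *)
have noeq z r : perm_eq (x :: y :: rest) [:: z, z & r] -> z < 3.
  move=> pz; rewrite ltnNge; apply/negP => z3.
  have [S [S0 S1 S2 S3 W]] := recoloring_states sp lam0 pz.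
  case: z z3 {pz} S0 W => // z z3 S0 W.
  have H := S3 _ _ _ _ (S2 _ _ _ _ S0); have {}H := H ltac:(lia) ltac:(lia).
  have := W (pred1 z.+1) _ _ _ H; rewrite /weight /= eqxx.
  have -> : (z == z.+1) = false by lia.
  have -> : (2 == z.+1) = false by lia.
  lia.
have yx : x <= y.+1 <= x.+1.
  by rewrite noalmost ?mem_head // ltnS (mon 0 1).
have [E|E] : y = x \/ x = y.+1 by lia.
  by have := noeq x rest; rewrite E perm_refl => /(_ isT); lia.
case: rest => [|z rest] in mon plam slam lam0 sp xmax noalmost noeq *.
  have [y2|y3] : y = 2 \/ 2 < y by lia.
    by right; exists 1; rewrite E y2.
  have [y4|y4] : y = 3 \/ 3 < y by lia.
    by case: not_schur_positive_43; rewrite E y4 in sp.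
  (* Parts [w + 2] and [w + 1]: three moves to the fresh color yield sizes [w], [w], 3. With sizes
     above [w] critical these weigh 3 instead of 4, as long as [3 < w + 1]. For [w = 2] the new
     class is itself critical, so [(4, 3)] escapes. *)
  exfalso; have [S [S0 S1 S2 S3 W]] := recoloring_states sp lam0 (perm_refl _).
  subst x; case: y y4 S0 W {x3 yx y3 mon plam slam lam0 sp xmax noalmost noeq} => // w w3 S0 W.
  have H1 := S2 w.+1 w.+1 0 ltac:(lia) S0.
  have H2 := S2 w w.+1 1 ltac:(lia) H1.
  have H3 := S3 w w 2 ltac:(lia) H2.
  have := W (leq w.+1) _ _ _ H3; rewrite /weight /= leqnSn leqnn ltnn.
  have -> : (w.+1 <= 3) = false by lia.
  lia.
(* A third part is at least [x - 1 = y] and at most [y], so it repeats [y] and the exclusion of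
   equal parts applies. *)
have zy : y <= z <= y.
  have := mon 1 2 isT; have := noalmost z; rewrite !inE eqxx !orbT /= => /(_ isT).
  by rewrite /= E ltnS => -> ->.
have Ez : z = y by lia.
have y2 : y = 2.
  have : y < 3; last by lia.
  apply: (noeq y (x :: rest)); rewrite Ez; apply/permP => P /=; lia.
right; exists (size rest).+2; split=> //.
rewrite E y2 Ez y2 /=; congr [:: _, _, _ & _].
apply/all_pred1P/allP => t tr /=.
have := noalmost t; rewrite !inE tr !orbT => /(_ isT).
have : t \in behead (behead (x :: y :: z :: rest)) by rewrite inE tr orbT.
move: (slam) => /= /and3P[_ _]; rewrite (path_sortedE (rev_trans leq_trans)).
by move=> /andP[/allP/(_ t tr) /= tz _] _; rewrite E; lia.
Qed.

(** * Tableaux with at most three columns as words *)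

Definition shape3 (p q u : nat) : seq nat :=
  mkseq (fun i => (i < p) + (i < q) + (i < u)) p.

Lemma shape3_partition p q u : is_partition (shape3 p q u).
Proof.
apply/andP; split.
  apply/(sortedP 0) => i; rewrite size_mkseq => ip; rewrite !nth_mkseq ?(ltnW ip) //=; lia.
apply/(all_nthP 0) => i; rewrite size_mkseq => ip; rewrite nth_mkseq //; lia.
Qed.

Definition letter := (bool * bool * bool)%type.

Definition proj (k : nat) (x : letter) : bool :=
  match k with 0 => x.1.1 | 1 => x.1.2 | _ => x.2 end.

Definition letter_size (x : letter) : nat := x.1.1 + x.1.2 + x.2.

Definition all_letters : seq letter :=
  [seq (ab.1, ab.2, d) | ab <- [seq (a, b) | a <- [:: true; false], b <- [:: true; false]],
                         d <- [:: true; false]].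

Definition letters (p q u m : nat) : seq letter :=
  [seq x <- all_letters | [&& letter_size x == m, x.1.1 <= p, x.1.2 <= q & x.2 <= u]].

Lemma mem_letters p q u m x :
  (x \in letters p q u m) = [&& letter_size x == m, x.1.1 <= p, x.1.2 <= q & x.2 <= u].
Proof. by rewrite mem_filter andb_idr //; case: x => [[[] []] []]. Qed.

Lemma uniq_letters p q u m : uniq (letters p q u m).
Proof. by rewrite filter_uniq. Qed.

Arguments letters : simpl never.

(* A tableau with columns of heights [p], [q], [u] is recorded by the set of
   columns containing each color, largest color first. *)
Fixpoint lattice_words (p q u : nat) (ms : seq nat) : seq (seq letter) :=
  if ms is m :: ms' then
    if u <= q <= p then
      [seq x :: w | x : letter <- letters p q u m,
                    w : seq letter <- lattice_words (p - x.1.1) (q - x.1.2) (u - x.2) ms']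
    else [::]
  else if [&& p == 0, q == 0 & u == 0] then [:: [::]] else [::].

(** A suffix keeps the colors up to some bound, so this compares, for every bound, how many entries
    of adjacent columns do not exceed it. *)
Fixpoint dominated (w : seq letter) : bool :=
  if w is x :: w' then
    (count (proj 2) w <= count (proj 1) w <= count (proj 0) w) && dominated w'
  else true.

Lemma mem_lattice_words p q u ms w :
  (w \in lattice_words p q u ms) =
  [&& map letter_size w == ms, dominated w, count (proj 0) w == p,
      count (proj 1) w == q & count (proj 2) w == u].
Proof.
elim: ms w p q u => [|m ms IH] [|x w] p q u //=.
- by rewrite ![0 == _]eq_sym; case: and3P.
- by case: and3P.
- by case: ifP => // _; apply/allpairsPdep => -[? [? []]].
case: ifP => qp; last first.
  apply/esym/negP => /and4P[_ /andP[H _] /eqP cp /andP[/eqP cq /eqP cu]].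
  by move: H; rewrite cp cq cu qp.
apply/allpairsPdep/idP => [[y [v [yl vl [-> ->]]]]|].
  move: yl vl; rewrite mem_letters IH => /and4P[/eqP ym yp yq yu].
  case/and5P=> /eqP <- dw /eqP cp /eqP cq /eqP cu.
  rewrite ym eqxx dw cp cq cu /proj !subnKC //= !eqxx andbT.
  by rewrite qp.
case/and5P=> /eqP[xm wm] /andP[_ dw] /eqP cp /eqP cq /eqP cu; exists x, w.
rewrite mem_letters IH wm dw eqxx -cp -cq -cu /= !addKn !eqxx.
by split=> //; rewrite xm eqxx !leq_addr.
Qed.

Lemma uniq_lattice_words p q u ms : uniq (lattice_words p q u ms).
Proof.
elim: ms p q u => [|m ms IH] p q u /=; first by case: ifP.
case: ifP => // _; apply: allpairs_uniq_dep => //; first exact: uniq_letters.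
by move=> [? ?] [? ?] _ _ /= [-> ->].
Qed.

(** For increasing sequences this is the row condition between adjacent columns: [A] is at least as
    long as [B] and entrywise at most [B]. The form by counts is the one that a ballot condition
    yields. *)
Definition dominates (A B : seq nat) : Prop :=
  forall c, count (leq^~ c) B <= count (leq^~ c) A.

Lemma dominates_trans A B C : dominates A B -> dominates B C -> dominates A C.
Proof. by move=> AB BC c; apply: leq_trans (BC c) (AB c). Qed.

Lemma dominates_nth A B : sorted leq A -> sorted leq B ->
  dominates A B <->
  (forall i, i < size B -> i < size A /\ nth 0 A i <= nth 0 B i).
Proof.
move=> sA sB; split=> [AB i iB|AB c].
  have : i < count (leq^~ (nth 0 B i)) A.
    by apply: leq_trans (AB _); rewrite -sorted_nth_leq.
  move=> iA; have iA' : i < size A by apply: leq_trans iA (count_size _ _).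
  by rewrite sorted_nth_leq.
rewrite leqNgt; apply/negP => AltB.
have iB : count (leq^~ c) A < size B by apply: leq_trans AltB (count_size _ _).
have [iA le] := AB _ iB.
have : nth 0 B (count (leq^~ c) A) <= c by rewrite sorted_nth_leq.
by move/(leq_trans le); rewrite sorted_nth_leq // ltnn.
Qed.

Definition column (cr : seq nat) (w : seq letter) (k : nat) : seq nat :=
  rev (mask (map (proj k) w) cr).

Lemma count_column_le cr w k c : size w = size cr -> (forall d, d \in cr -> d <= c) ->
  count (leq^~ c) (column cr w k) = count (proj k) w.
Proof.
move=> sw crc; rewrite count_rev -[RHS](count_map (proj k) id).
rewrite -(size_mask (s := cr)) ?size_map //; apply/eqP; rewrite -all_count.
by apply/allP => d /mem_mask /crc.
Qed.

Lemma dominatedP cr w : sorted gtn cr -> size w = size cr ->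
  dominated w <->
  dominates (column cr w 0) (column cr w 1) /\
  dominates (column cr w 1) (column cr w 2).
Proof.
elim: cr w => [|c cr IH] [|x w] // scr.
have gtn_trans : transitive gtn by move=> a b d /= ab bd; exact: ltn_trans bd ab.
move: scr => /=; rewrite (path_sortedE gtn_trans) => /andP[/allP ccr scr] [sw].
have large d : d \in c :: cr -> d <= c.
  by rewrite inE => /orP[/eqP ->//|/ccr /ltnW].
have lt e k : e < c ->
    count (leq^~ e) (column (c :: cr) (x :: w) k) = count (leq^~ e) (column cr w k).
  by move=> ec; rewrite !count_rev /=; case: (proj k x) => //=; rewrite leqNgt ec.
have ge e k : c <= e ->
    count (leq^~ e) (column (c :: cr) (x :: w) k) = count (proj k) (x :: w).
  move=> ce; apply: count_column_le; rewrite /= ?sw // => d /large dc.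
  exact: leq_trans dc ce.
have ge' e k : c <= e.+1 -> count (leq^~ e) (column cr w k) = count (proj k) w.
  move=> ce; apply: count_column_le; rewrite // => d /ccr /= dc.
  by rewrite -ltnS (leq_trans dc).
split=> [/andP[/andP[w21 w10] /(IH _ scr sw)[d01 d12]]|[d01 d12]].
  split=> e; case: (ltnP e c) => ec; rewrite ?(lt _ _ ec) ?(ge _ _ ec) //.
apply/andP; split; first by have := d01 c; have := d12 c; rewrite !ge // => -> ->.
have red i j : dominates (column (c :: cr) (x :: w) i) (column (c :: cr) (x :: w) j) ->
    dominates (column cr w i) (column cr w j).
  move=> dij e; case: (ltnP e c) => ec; first by have := dij e; rewrite !lt.
  (* All colors of the tail are below [c], so from the bound [c - 1] on its counts are constant; for
     [c = 0] the tail is empty. *)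
  case: c ccr lt large ge ge' ec dij d01 d12 => [|c] ccr lt large ge ge' ec dij _ _.
    case: cr w {IH scr lt large ge ge' dij} sw ccr => [|d cr] [|y w] // _ ccr.
    by have := ccr d (mem_head _ _).
  rewrite !ge' ?(leq_trans ec) // -!(ge' c) // -!lt //; exact: dij.
by apply/IH => //; split; apply: red.
Qed.

Lemma sorted_column cr w k : sorted gtn cr -> sorted ltn (column cr w k).
Proof.
move=> scr; rewrite rev_sorted; apply: sorted_mask scr.
by move=> a b d /= ab bd; exact: ltn_trans bd ab.
Qed.

Lemma sum_iota n (F : nat -> nat) : \sum_(i <- iota 0 n) F i = \sum_(i < n) F i.
Proof. by rewrite -(big_mkord xpredT) /index_iota subn0. Qed.

Section Heights.
Variables (p q u : nat).
Hypothesis hts : u <= q <= p.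

Definition height (k : nat) := match k with 0 => p | 1 => q | _ => u end.

Lemma shape3_cell i k : k < 3 ->
  (k < nth 0 (shape3 p q u) i) = (i < height k).
Proof.
move=> k3; have [ip|pi] := ltnP i p.
  by rewrite nth_mkseq //; case: k k3 => [|[|[|]]] //= _; lia.
rewrite nth_default ?size_mkseq // ltn0.
by case: k k3 => [|[|[|]]] //= _; lia.
Qed.

Lemma shape3_col_lt (x : cell (shape3 p q u)) : cell_col x < 3.
Proof.
apply: leq_trans (cell_col_lt x) _; rewrite nth_mkseq; first by lia.
by have := cell_row_lt x; rewrite size_mkseq.
Qed.

Lemma shape3_row_lt (x : cell (shape3 p q u)) : cell_row x < height (cell_col x).
Proof. by rewrite -shape3_cell ?shape3_col_lt ?cell_col_lt. Qed.

Lemma shape3_cellP i k : k < 3 -> i < height k ->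
  exists2 x : cell (shape3 p q u), cell_row x = i & cell_col x = k.
Proof.
move=> k3 ik; apply: cellP; last by rewrite shape3_cell.
by rewrite size_mkseq; case: k k3 ik => [|[|[|]]] //= _; lia.
Qed.

Definition fcolumn (f : {ffun cell (shape3 p q u) -> nat}) k :=
  mkseq (fun i => entry f i k) (height k).

Lemma perm_codom_columns (f : {ffun cell (shape3 p q u) -> nat}) :
  perm_eq (codom f) (fcolumn f 0 ++ fcolumn f 1 ++ fcolumn f 2).
Proof.
apply/permP => P; rewrite codom_entry !count_cat count_flatten -map_comp sumnE big_map.
rewrite size_mkseq /fcolumn /= sum_iota.
have cm g n : n <= p -> count P (mkseq g n) = \sum_(i < p) (i < n) * P (g i).
  move=> np; rewrite -sum1_count big_map big_mkcond /= sum_iota.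
  rewrite (big_ord_widen_cond p xpredT (fun i => if P (g i) then 1 else 0)) //.
  by rewrite big_mkcond; apply: eq_bigr => i _ /=; case: (i < n); case: (P _).
rewrite !cm; [|lia..]; rewrite -!big_split; apply: eq_bigr => i _ /=.
rewrite /shape3 nth_mkseq // ltn_ord /=.
have [iu|ui] := ltnP i u; have [iq|qi] := ltnP i q => //=; try lia;
  by rewrite /mkseq /= ?addn0 ?addnA; lia.
Qed.

Lemma semistandard_columns (f : {ffun cell (shape3 p q u) -> nat}) : semistandard f <->
  [/\ forall k, k < 3 -> sorted ltn (fcolumn f k),
      dominates (fcolumn f 0) (fcolumn f 1)
    & dominates (fcolumn f 1) (fcolumn f 2)].
Proof.
have sz k : size (fcolumn f k) = height k by rewrite size_mkseq.
have E x : f x = nth 0 (fcolumn f (cell_col x)) (cell_row x).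
  by rewrite nth_mkseq ?shape3_row_lt // entryE.
have ltnle s : sorted ltn s -> sorted leq s.
  by apply: sub_sorted => a b /= /ltnW.
split=> [sf|[sc d01 d12]].
  have sc k : k < 3 -> sorted ltn (fcolumn f k).
    move=> k3; apply/(sortedP 0) => i; rewrite sz => ik.
    have [x xr xc] := shape3_cellP k3 ik; have [y yr yc] := shape3_cellP k3 (ltnW ik).
    have := E x; have := E y; rewrite xr xc yr yc => <- <-.
    by apply: semistandard_col sf _ _; rewrite ?xc ?xr ?yr.
  have dm k : k < 2 -> dominates (fcolumn f k) (fcolumn f k.+1).
    move=> k2; have k3 : k < 3 by rewrite ltnW.
    apply/dominates_nth; rewrite ?ltnle ?sc // => i; rewrite !sz => ik1.
    have ik : i < height k by case: k k2 {k3} ik1 => [|[|]] //= _; lia.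
    split=> //; have [x xr xc] := shape3_cellP (k2 : k.+1 < 3) ik1.
    have [y yr yc] := shape3_cellP k3 ik.
    have := E x; have := E y; rewrite xr xc yr yc => <- <-.
    by apply: semistandard_row sf _ _; rewrite ?xr ?xc ?yc.
  by split=> //; apply: dm.
have d02 := dominates_trans d01 d12.
apply/'forall_forallP => x y; have [x3 y3] := (shape3_col_lt x, shape3_col_lt y).
apply/andP; split; apply/implyP => /andP[/eqP e lt]; rewrite !E.
  have dxy : dominates (fcolumn f (cell_col x)) (fcolumn f (cell_col y)).
    by move: x3 y3 lt; do 2!case: (cell_col _) => [|[|[|?]]] //.
  have /(dominates_nth (ltnle _ (sc _ x3)) (ltnle _ (sc _ y3))) := dxy.
  by move=> /(_ (cell_row y)); rewrite sz shape3_row_lt -e => /(_ isT)[].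
rewrite e; apply: (sorted_ltn_nth ltn_trans 0 (sc _ y3)); rewrite // inE sz.
  by rewrite -e shape3_row_lt.
exact: shape3_row_lt.
Qed.

Lemma schur_shape3 ms :
  let cr := rev (sort leq (undup ms)) in
  schur (shape3 p q u) (content_monomial ms)
    = (size (lattice_words p q u [seq count_mem c ms | c <- cr]))%:R%R.
Proof.
move=> cr.
have ucr : uniq cr by rewrite rev_uniq sort_uniq undup_uniq.
have mcr : cr =i ms by move=> c; rewrite mem_rev mem_sort mem_undup.
have scr : sorted gtn cr.
  rewrite rev_sorted ltn_sorted_uniq_leq sort_uniq undup_uniq.
  exact: (sort_sorted leq_total).
pose dec (w : seq letter) : {ffun cell (shape3 p q u) -> nat} :=
  [ffun x => nth 0 (column cr w (cell_col x)) (cell_row x)].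
have sizes w : w \in lattice_words p q u [seq count_mem c ms | c <- cr] ->
    size w = size cr /\ forall k, k < 3 -> size (column cr w k) = height k.
  rewrite mem_lattice_words => /and5P[/eqP wm _ /eqP cp /eqP cq /eqP cu].
  have sw : size w = size cr by rewrite -(size_map letter_size) wm size_map.
  split=> // k k3; rewrite size_rev size_mask ?size_map // count_map.
  by case: k k3 => [|[|[|]]] //= _; rewrite -?cp -?cq -?cu.
have decE w k : w \in lattice_words p q u [seq count_mem c ms | c <- cr] ->
    k < 3 -> fcolumn (dec w) k = column cr w k.
  move=> /sizes[_ sz] k3; apply: (@eq_from_nth _ 0); rewrite size_mkseq ?sz // => i ik.
  rewrite nth_mkseq //; have [x <- <-] := shape3_cellP k3 ik.
  by rewrite entryE ffunE.
(* [cr] has no repetition, so a mask is recovered from the colors it selects, and hence a word from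
   its columns. *)
have maskE (b : bitseq) : size b = size cr -> b = [seq c \in mask b cr | c <- cr].
  move=> sb; apply: (@eq_from_nth _ false); rewrite ?size_map // => i ib.
  by rewrite (nth_map 0) ?in_mask ?mem_nth -?sb ?index_uniq // -sb.
have wE w : size w = size cr ->
    w = [seq (c \in column cr w 0, c \in column cr w 1, c \in column cr w 2) | c <- cr].
  move=> sw; have B k : map (proj k) w = [seq c \in column cr w k | c <- cr].
    rewrite [LHS]maskE ?size_map //; apply: eq_map => c.
    by rewrite mem_rev.
  apply: (@eq_from_nth _ (false, false, false)); rewrite ?size_map // => i iw.
  have icr : i < size cr by rewrite -sw.
  have nB k : proj k (nth (false, false, false) w i) = (nth 0 cr i \in column cr w k).
    rewrite -(nth_map 0 false (fun c => c \in column cr w k)) // -B.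
    by rewrite (nth_map (false, false, false)).
  by rewrite (nth_map 0) // -!nB; case: (nth _ w i) => [[]].
apply: (@genfun_size _ _ _ _ _ dec); first exact: uniq_lattice_words.
- move=> w w' ws ws' E; have [sw _] := sizes _ ws; have [sw' _] := sizes _ ws'.
  by rewrite (wE _ sw) (wE _ sw') -!decE // E.
- move=> w ws; have [sw sz] := sizes _ ws.
  have := ws; rewrite mem_lattice_words => /and5P[/eqP wm dw _ _ _].
  have [d01 d12] := (dominatedP scr sw).1 dw.
  apply/andP; split.
    by apply/semistandard_columns; split=> [k k3||]; rewrite !decE // sorted_column.
  rewrite (permPl (perm_codom_columns _)) !decE //; apply/allP => c _ /=.
  have cc k : count_mem c (column cr w k) = (c \in column cr w k).
    by rewrite count_uniq_mem // rev_uniq mask_uniq.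
  rewrite !count_cat !cc; have [cin|cnin] := boolP (c \in ms); last first.
    have cw k : (c \in column cr w k) = false.
      by apply/negP; rewrite mem_rev => /mem_mask; rewrite mcr; apply/negP.
    by rewrite (count_memPn cnin) !cw.
  rewrite -mcr in cin; have ic : index c cr < size cr by rewrite index_mem.
  have := congr1 (nth 0 ^~ (index c cr)) wm.
  rewrite (nth_map (false, false, false)) ?sw // (nth_map 0) // nth_index // => <-.
  have -> := congr1 (nth (false, false, false) ^~ (index c cr)) (wE _ sw).
  by rewrite (nth_map 0) // nth_index // /letter_size /= addnA.
move=> f /semistandard_columns[sc d01 d12] pf.
have pcol : perm_eq (fcolumn f 0 ++ fcolumn f 1 ++ fcolumn f 2) ms.
  by rewrite -(permPl (perm_codom_columns f)).
pose w : seq letter :=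
  [seq (c \in fcolumn f 0, c \in fcolumn f 1, c \in fcolumn f 2) | c <- cr].
have sw : size w = size cr by rewrite size_map.
have colE k : k < 3 -> column cr w k = fcolumn f k.
  move=> k3; rewrite /column -map_comp.
  have -> : map (proj k \o (fun c => (c \in fcolumn f 0, c \in fcolumn f 1, c \in fcolumn f 2))) cr
          = map (mem (fcolumn f k)) cr.
    by apply: eq_map => c; case: k k3 => [|[|[|]]].
  rewrite -filter_mask -filter_rev; apply: (irr_sorted_eq ltn_trans ltnn) => //.
  - apply: (sorted_filter ltn_trans); rewrite rev_sorted; exact: scr.
  - exact: sc.
  - move=> c; rewrite mem_filter mem_rev mcr andbC; apply: andb_idl => /= cf.
    rewrite -(perm_mem pcol) !mem_cat.
    by case: k k3 cf => [|[|[|]]] //= _ ->; rewrite ?orbT.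
have cnt k : k < 3 -> count (proj k) w = height k.
  move=> k3; rewrite -(count_map (proj k) id) -(size_mask (s := cr)) ?size_map //.
  by rewrite -size_rev -/(column cr w k) colE // size_mkseq.
have ws : w \in lattice_words p q u [seq count_mem c ms | c <- cr].
  rewrite mem_lattice_words !cnt // !eqxx !andbT; apply/andP; split.
    apply/eqP; rewrite -map_comp; apply: eq_map => c /=.
    rewrite -(permP pcol) !count_cat !count_uniq_mem ?addnA //;
    by apply: (sorted_uniq ltn_trans ltnn); apply: sc.
  by apply/(dominatedP scr sw); rewrite !colE.
exists w => //; apply/ffunP => x; rewrite ffunE colE ?shape3_col_lt //.
by rewrite nth_mkseq ?shape3_row_lt // entryE.
Qed.

End Heights.

(** * Coefficients of the chromatic function *)

Lemma mem_full_words_all x ms r : (r \in full_words x ms) =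
  (size r == x) && all (fun c => count_mem c r == count_mem c ms) r.
Proof.
rewrite mem_full_words; congr (_ && _); apply/idP/allP => [/permP rm c cr|rm].
  rewrite rm count_filter; apply/eqP/eq_count => d /=.
  by case: eqP => //= ->; rewrite cr.
apply/allP => c _ /=; rewrite count_filter.
have [cr|cr] := boolP (c \in r).
  rewrite (eqP (rm c cr)); apply/eqP/eq_count => d /=.
  by case: eqP => //= ->; rewrite cr.
rewrite (count_memPn cr) eq_sym; apply/eqP; rewrite (@eq_count _ _ pred0) ?count_pred0 // => d /=.
by case: eqP => //= ->; apply: negbTE.
Qed.

Lemma class_sum_full x ms r phi : r \in full_words x ms ->
  class_sum phi ms = class_sum phi r + class_sum phi (filter (predC (mem r)) ms).
Proof.
rewrite mem_full_words => /andP[_ rm].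
have pm : perm_eq (r ++ filter (predC (mem r)) ms) ms.
  by rewrite (permPl (perm_cat rm (perm_refl _))) perm_filterC.
rewrite -(class_sum_perm _ pm) class_sum_cat //.
by apply/hasPn => c; rewrite mem_filter => /andP[].
Qed.

Notation class_count i := (class_sum (fun x : nat => x == i)).
Notation class_big := (class_sum (leq 4)).

Definition colors_of (i : nat) (ms : seq nat) :=
  [seq c <- undup ms | count_mem c ms == i].

Lemma mem_colors_of i ms c : (c \in colors_of i.+1 ms) = (count_mem c ms == i.+1).
Proof.
rewrite mem_filter mem_undup andb_idr // => /eqP cm.
by rewrite -has_pred1 has_count cm.
Qed.

Lemma uniq_colors_of i ms : uniq (colors_of i ms).
Proof. by rewrite filter_uniq ?undup_uniq. Qed.

Lemma size_colors_of i ms : size (colors_of i ms) = class_count i ms.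
Proof. by rewrite size_filter -sum1_count big_mkcond; apply: eq_bigr => c _; case: eqP. Qed.

Lemma perm_full_words1 ms :
  perm_eq (full_words 1 ms) [seq [:: c] | c <- colors_of 1 ms].
Proof.
apply: uniq_perm; rewrite ?uniq_full_words ?map_inj_uniq ?uniq_colors_of //.
  by move=> c d [].
move=> r; rewrite mem_full_words_all; apply/idP/mapP => [|[c cm ->]].
  case: r => [|c [|d r]] //=; rewrite eqxx andbT => /eqP cm; exists c => //.
  by rewrite mem_colors_of -cm.
by move: cm; rewrite mem_colors_of /= eqxx andbT eq_sym.
Qed.

Lemma perm_full_words2 ms :
  perm_eq (full_words 2 ms)
    ([seq [:: c; c] | c <- colors_of 2 ms] ++
     [seq [:: c; d] | c <- colors_of 1 ms, d <- rem c (colors_of 1 ms)]).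
Proof.
apply: uniq_perm; rewrite ?uniq_full_words //.
  rewrite cat_uniq map_inj_uniq ?uniq_colors_of /=; last by move=> c d [].
  apply/andP; split.
    apply/hasPn => r /allpairsPdep[c [d [cm dm ->]]].
    apply/mapP => -[e em [ec ed]]; move: dm.
    by rewrite mem_rem_uniq ?uniq_colors_of // inE ed ec eqxx.
  apply: allpairs_uniq_dep; rewrite ?uniq_colors_of //.
    by move=> c _; rewrite rem_uniq ?uniq_colors_of.
  by move=> [c d] [c' d'] _ _ /= [-> ->].
move=> r; rewrite mem_full_words_all mem_cat; apply/idP/orP.
  case: r => [|c [|d [|]]] //=; rewrite !eqxx.
  have [->|dc] := eqVneq d c; rewrite ?(eq_sym c d) ?(negPf dc) ?eqxx /= andbT.
    by move=> /andP[/eqP cm _]; left; apply: map_f; rewrite mem_colors_of -cm.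
  move=> /andP[/eqP cm /eqP dm]; right; apply/allpairsPdep; exists c, d.
  by rewrite mem_rem_uniq ?uniq_colors_of // inE dc !mem_colors_of -cm -dm.
case=> [/mapP[c cm ->]|/allpairsPdep[c [d [cm dm ->]]]] /=.
  by move: cm; rewrite mem_colors_of !eqxx => /eqP ->.
move: cm dm; rewrite mem_rem_uniq ?uniq_colors_of // inE !mem_colors_of.
by move=> /eqP -> /andP[dc /eqP ->]; rewrite !eqxx (eq_sym c d) (negPf dc).
Qed.

Lemma perm_full_words3 ms (U1 := colors_of 1 ms) (U2 := colors_of 2 ms) :
  perm_eq (full_words 3 ms)
    ([seq [:: c; c; c] | c <- colors_of 3 ms] ++
     [seq [:: c; c; d] | c <- U2, d <- U1] ++
     [seq [:: c; d; c] | c <- U2, d <- U1] ++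
     [seq [:: d; c; c] | c <- U2, d <- U1] ++
     [seq [:: c; de.1; de.2] | c <- U1,
        de <- [seq (d, e) | d <- rem c U1, e <- rem d (rem c U1)]]).
Proof.
have u1 : uniq U1 by exact: uniq_colors_of.
have u2 : uniq U2 by exact: uniq_colors_of.
have U21 c d : c \in U2 -> d \in U1 -> (c == d) = false.
  by rewrite !mem_colors_of => /eqP cm /eqP dm; apply/eqP => cd; rewrite cd dm in cm.
have inj : uniq [seq [:: c; c; d] | c <- U2, d <- U1] /\
   uniq [seq [:: c; d; c] | c <- U2, d <- U1] /\
   uniq [seq [:: d; c; c] | c <- U2, d <- U1].
  by split; [|split]; apply: allpairs_uniq => // -[c d] [c' d'] _ _ /= [] *; congr pair.
have mem5 r : (r \in [seq [:: c; de.1; de.2] | c <- U1,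
        de <- [seq (d, e) | d <- rem c U1, e <- rem d (rem c U1)]]) <->
    exists c d e, [/\ r = [:: c; d; e], [/\ c \in U1, d \in U1 & e \in U1] &
       [/\ d != c, e != c & e != d]].
  split.
    move=> /allpairsPdep[c [[d' e'] [cU /allpairsPdep[d [e [dU eU [-> ->]]]] ->]]].
    move: dU eU; rewrite !mem_rem_uniq ?rem_uniq // !inE => /andP[dc dU].
    rewrite mem_rem_uniq // inE => /and3P[ed ec eU].
    by exists c, d, e.
  case=> c [d [e [-> [cU dU eU] [dc ec ed]]]]; apply/allpairsPdep; exists c, (d, e).
  split=> //; apply/allpairsPdep; exists d, e.
  split=> //; first by rewrite mem_rem_uniq // inE dc.
  by rewrite mem_rem_uniq ?rem_uniq // inE ed mem_rem_uniq // inE ec.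
apply: uniq_perm; rewrite ?uniq_full_words //.
  have [i1 [i2 i3]] := inj.
  rewrite !cat_uniq i1 i2 i3 map_inj_uniq ?uniq_colors_of /=; last by move=> c d [].
  rewrite !has_cat !negb_or -!andbA; apply/and5P; split.
  - apply/hasPn => r /allpairsP[[c d] /= [cU dU ->]]; apply/mapP => -[e _ [E1 _ E2]].
    by have := U21 _ _ cU dU; rewrite E1 E2 eqxx.
  - apply/hasPn => r /allpairsP[[c d] /= [cU dU ->]]; apply/mapP => -[e _ [E1 E2 _]].
    by have := U21 _ _ cU dU; rewrite E1 E2 eqxx.
  - apply/hasPn => r /allpairsP[[c d] /= [cU dU ->]]; apply/mapP => -[e _ [E1 E2 _]].
    by have := U21 _ _ cU dU; rewrite E1 E2 eqxx.
  - apply/hasPn => r /mem5[c [d [e [-> _ [dc _ _]]]]].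
    by apply/mapP => -[f _ [E1 E2 _]]; rewrite E1 E2 eqxx in dc.
  apply/and5P; split.
  - apply/hasPn => r /allpairsP[[c d] /= [cU dU ->]].
    apply/allpairsP => -[[c' d'] /= [cU' dU' [E1 E2 _]]].
    by have := U21 _ _ cU dU; rewrite E1 E2 eqxx.
  - apply/hasPn => r /allpairsP[[c d] /= [cU dU ->]].
    apply/allpairsP => -[[c' d'] /= [cU' dU' [E1 E2 _]]].
    by have := U21 _ _ cU dU; rewrite E1 E2 eqxx.
  - apply/hasPn => r /mem5[c [d [e [-> _ [dc _ _]]]]].
    by apply/allpairsP => -[[c' d'] /= [_ _ [E1 E2 _]]]; rewrite E1 E2 eqxx in dc.
  - apply/hasPn => r /allpairsP[[c d] /= [cU dU ->]].
    apply/allpairsP => -[[c' d'] /= [cU' dU' [E1 _ E2]]].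
    by have := U21 _ _ cU dU; rewrite E1 E2 eqxx.
  apply/and3P; split.
  - apply/hasPn => r /mem5[c [d [e [-> _ [_ ec _]]]]].
    by apply/allpairsP => -[[c' d'] /= [_ _ [E1 _ E2]]]; rewrite E1 E2 eqxx in ec.
  - apply/hasPn => r /mem5[c [d [e [-> _ [_ _ ed]]]]].
    by apply/allpairsP => -[[c' d'] /= [_ _ [_ E1 E2]]]; rewrite E1 E2 eqxx in ed.
  apply: allpairs_uniq_dep => // [c cU|].
    apply: allpairs_uniq_dep; rewrite ?rem_uniq //; first by move=> d _; rewrite !rem_uniq.
    by move=> [d e] [d' e'] _ _ /= [-> ->].
  by move=> [c [d e]] [c' [d' e']] _ _ /= [-> -> ->].
move=> r; rewrite mem_full_words_all !mem_cat; apply/idP/idP.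
  case: r => [|c [|d [|e [|]]]] //=; rewrite !eqxx.
  have [->|dc] := eqVneq d c; have [->|ec] := eqVneq e c;
    rewrite ?eqxx ?(eq_sym c) ?(negPf dc) ?(negPf ec) ?(eq_sym e d) /= ?andbT.
  - by move=> /andP[/eqP cm _]; rewrite map_f // mem_colors_of -cm.
  - move=> /and3P[/eqP cm _ /eqP em]; apply/orP; right.
    apply/orP; left; apply/allpairsP; exists (c, e).
    by rewrite !mem_colors_of -cm -em.
  - move=> /and3P[/eqP cm /eqP dm _]; do 2!(apply/orP; right).
    apply/orP; left; apply/allpairsP; exists (c, d).
    by rewrite !mem_colors_of -cm -dm.
  have [->|ed] := eqVneq d e; rewrite ?eqxx /=.
    move=> /and3P[/eqP cm /eqP em _]; do 3!(apply/orP; right).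
    apply/orP; left; apply/allpairsP; exists (e, c).
    by rewrite !mem_colors_of -cm -em.
  move=> /and3P[/eqP cm /eqP dm /eqP em]; do 4!(apply/orP; right).
  apply/mem5; exists c, d, e; rewrite !mem_colors_of -cm -dm -em.
  by split=> //; split=> //; rewrite eq_sym.
case/or4P=> [/mapP[c cm ->]|/allpairsP[[c d] /= [cm dm ->]]|/allpairsP[[c d] /= [cm dm ->]]|] /=.
- by move: cm; rewrite mem_colors_of !eqxx => /eqP ->.
- have cd := U21 _ _ cm dm; move: cm dm; rewrite !mem_colors_of => /eqP -> /eqP ->.
  by rewrite (eq_sym d) cd !eqxx.
- have cd := U21 _ _ cm dm; move: cm dm; rewrite !mem_colors_of => /eqP -> /eqP ->.
  by rewrite (eq_sym d) cd !eqxx.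
case/orP=> [/allpairsP[[c d] /= [cm dm ->]]|/mem5[c [d [e [-> [cU dU eU] [dc ec ed]]]]]] /=.
  have cd := U21 _ _ cm dm; move: cm dm; rewrite !mem_colors_of => /eqP -> /eqP ->.
  by rewrite (eq_sym d) cd !eqxx.
move: cU dU eU; rewrite !mem_colors_of => /eqP -> /eqP -> /eqP ->.
by rewrite !eqxx ![c == _]eq_sym [d == e]eq_sym (negPf dc) (negPf ec) (negPf ed).
Qed.

Lemma size_colorings_cons x lam ms : size (colorings (x :: lam) ms) =
  \sum_(r <- full_words x ms) size (colorings lam (filter (predC (mem r)) ms)).
Proof. by rewrite /= size_allpairs_dep sumnE big_map. Qed.

(** The parts to be treated have size at most 3 and never use a class of size 4 or more, so one
    joint count of the large classes is enough. *)
Definition profile_fun (F : nat -> nat -> nat -> nat -> nat) (ms : seq nat) :=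
  F (class_count 1 ms) (class_count 2 ms) (class_count 3 ms) (class_big ms).

Lemma class_sum_cat_nseq phi x c s : c \notin s ->
  class_sum phi (nseq x.+1 c ++ s) = phi x.+1 + class_sum phi s.
Proof.
move=> cs; rewrite class_sum_cat ?class_sum_nseq //.
apply/hasPn => d ds; apply/negP => dn; have : d \in nseq x.+1 c by [].
by rewrite mem_nseq => /eqP dc; rewrite -dc ds in cs.
Qed.

Lemma class_sum_nil phi : class_sum phi [::] = 0.
Proof. by rewrite /class_sum big_nil. Qed.

Lemma sum_const_seq (T : Type) (s : seq T) n : \sum_(x <- s) n = size s * n.
Proof. by rewrite big_const_seq count_predT iter_addn_0 mulnC. Qed.

Section Step.
Variables (lam : seq nat) (F : nat -> nat -> nat -> nat -> nat).
Hypothesis HF : forall ms, size (colorings lam ms) = profile_fun F ms.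

Lemma size_colorings_full x ms r : r \in full_words x ms ->
  size (colorings lam (filter (predC (mem r)) ms)) =
  F (class_count 1 ms - class_count 1 r) (class_count 2 ms - class_count 2 r)
    (class_count 3 ms - class_count 3 r) (class_big ms - class_big r).
Proof.
by move=> rf; rewrite HF /profile_fun !(class_sum_full _ rf) !addKn.
Qed.

Lemma sum_full_words x ms s v : perm_eq (full_words x ms) s ->
  {in s, forall r, size (colorings lam (filter (predC (mem r)) ms)) = v r} ->
  size (colorings (x :: lam) ms) = \sum_(r <- s) v r.
Proof.
move=> ps sv; rewrite size_colorings_cons (perm_big _ ps) /= big_seq [RHS]big_seq.
exact: eq_bigr.
Qed.

Lemma size_colorings1 ms : size (colorings (1 :: lam) ms) =
  class_count 1 ms *
    F (class_count 1 ms).-1 (class_count 2 ms) (class_count 3 ms) (class_big ms).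
Proof.
have ps := perm_full_words1 ms.
rewrite (sum_full_words (v := fun=> F (class_count 1 ms).-1 (class_count 2 ms)
   (class_count 3 ms) (class_big ms)) ps).
  by rewrite sum_const_seq size_map size_colors_of.
move=> r rs; rewrite (@size_colorings_full 1) ?(perm_mem ps) //.
case/mapP: rs => c _ ->.
by rewrite !(@class_sum_nseq _ 0) subn1 !subn0.
Qed.

Lemma size_colorings2 ms : size (colorings (2 :: lam) ms) =
  class_count 2 ms *
    F (class_count 1 ms) (class_count 2 ms).-1 (class_count 3 ms) (class_big ms) +
  class_count 1 ms * (class_count 1 ms).-1 *
    F (class_count 1 ms - 2) (class_count 2 ms) (class_count 3 ms) (class_big ms).
Proof.
have ps := perm_full_words2 ms.
rewrite size_colorings_cons (perm_big _ ps) /= big_cat /=; congr (_ + _).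
  rewrite big_seq (eq_bigr (fun=> F (class_count 1 ms) (class_count 2 ms).-1
    (class_count 3 ms) (class_big ms))) => [|r rs].
    by rewrite -big_seq sum_const_seq size_map size_colors_of.
  rewrite (@size_colorings_full 2) ?(perm_mem ps) ?mem_cat ?rs //.
  case/mapP: rs => c _ ->.
  by rewrite !(@class_sum_nseq _ 1) subn1 !subn0.
rewrite big_seq (eq_bigr (fun=> F (class_count 1 ms - 2) (class_count 2 ms)
    (class_count 3 ms) (class_big ms))) => [|r rs].
  rewrite -big_seq sum_const_seq size_allpairs_dep sumnE big_map big_seq.
  rewrite (eq_bigr (fun=> (class_count 1 ms).-1)) => [|c cU].
    by rewrite -big_seq sum_const_seq size_colors_of.
  by rewrite size_rem // size_colors_of.
rewrite (@size_colorings_full 2) ?(perm_mem ps) ?mem_cat ?rs ?orbT //.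
case/allpairsPdep: rs => c [d [_ dU ->]].
have cd : c \notin [:: d].
  by move: dU; rewrite mem_rem_uniq ?uniq_colors_of // !inE eq_sym => /andP[].
by rewrite !(@class_sum_cat_nseq _ 0 c [:: d]) // !(@class_sum_nseq _ 0) !subn0.
Qed.

Lemma size_colorings3 ms : size (colorings (3 :: lam) ms) =
  class_count 3 ms *
    F (class_count 1 ms) (class_count 2 ms) (class_count 3 ms).-1 (class_big ms) +
  3 * (class_count 2 ms * class_count 1 ms) *
    F (class_count 1 ms).-1 (class_count 2 ms).-1 (class_count 3 ms) (class_big ms) +
  class_count 1 ms * ((class_count 1 ms).-1 * (class_count 1 ms - 2)) *
    F (class_count 1 ms - 3) (class_count 2 ms) (class_count 3 ms) (class_big ms).
Proof.
have ps := perm_full_words3 ms.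
have U21 c d : c \in colors_of 2 ms -> d \in colors_of 1 ms -> c \notin [:: d].
  rewrite !mem_colors_of inE => /eqP cm /eqP dm; apply/eqP => cd.
  by rewrite cd dm in cm.
(* The three positions of the single letter contribute equally, whence the factor 3. *)
have mid (E : nat -> nat -> seq nat) :
    (forall c d, c \in colors_of 2 ms -> d \in colors_of 1 ms ->
       perm_eq (E c d) [:: c; c; d] /\ E c d \in full_words 3 ms) ->
    \sum_(r <- [seq E c d | c <- colors_of 2 ms, d <- colors_of 1 ms])
       size (colorings lam (filter (predC (mem r)) ms)) =
    (class_count 2 ms * class_count 1 ms) *
      F (class_count 1 ms).-1 (class_count 2 ms).-1 (class_count 3 ms) (class_big ms).
  move=> EP; rewrite big_seq (eq_bigr (fun=> F (class_count 1 ms).-1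
     (class_count 2 ms).-1 (class_count 3 ms) (class_big ms))) => [|r].
    by rewrite -big_seq sum_const_seq size_allpairs !size_colors_of.
  case/allpairsP=> -[c d] /= [cU dU ->]; have [pE fE] := EP _ _ cU dU.
  rewrite (@size_colorings_full 3) // !(class_sum_perm _ pE).
  rewrite !(@class_sum_cat_nseq _ 1 c [:: d]) ?U21 // !(@class_sum_nseq _ 0).
  by rewrite !subn1 !subn0.
rewrite size_colorings_cons (perm_big _ ps) /= !big_cat /=.
rewrite (mid (fun c d => [:: c; c; d])); last first.
  move=> c d cU dU; split; first by apply/permP => P /=; lia.
  by rewrite (perm_mem ps) !mem_cat (allpairs_f (fun c d => [:: c; c; d]) cU dU) ?orbT.
rewrite (mid (fun c d => [:: c; d; c])); last first.
  move=> c d cU dU; split; first by apply/permP => P /=; lia.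
  by rewrite (perm_mem ps) !mem_cat (allpairs_f (fun c d => [:: c; d; c]) cU dU) ?orbT.
rewrite (mid (fun c d => [:: d; c; c])); last first.
  move=> c d cU dU; split; first by apply/permP => P /=; lia.
  by rewrite (perm_mem ps) !mem_cat (allpairs_f (fun c d => [:: d; c; c]) cU dU) ?orbT.
rewrite -!addnA !mulSn mul0n addn0 !mulnDl -!addnA; congr (_ + _); last do 3!congr (_ + _).
  rewrite big_seq (eq_bigr (fun=> F (class_count 1 ms) (class_count 2 ms)
    (class_count 3 ms).-1 (class_big ms))) => [|r rs].
    by rewrite -big_seq sum_const_seq size_map size_colors_of.
  rewrite (@size_colorings_full 3) ?(perm_mem ps) ?mem_cat ?rs //.
  case/mapP: rs => c _ ->.
  by rewrite !(@class_sum_nseq _ 2) subn1 !subn0.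
rewrite big_seq (eq_bigr (fun=> F (class_count 1 ms - 3) (class_count 2 ms)
    (class_count 3 ms) (class_big ms))) => [|r rs].
  rewrite -big_seq sum_const_seq size_allpairs_dep sumnE big_map big_seq.
  rewrite (eq_bigr (fun=> (class_count 1 ms).-1 * (class_count 1 ms - 2))) => [|c cU].
    by rewrite -big_seq sum_const_seq size_colors_of.
  rewrite size_allpairs_dep sumnE big_map big_seq.
  rewrite (eq_bigr (fun=> class_count 1 ms - 2)) => [|d dU].
    by rewrite -big_seq sum_const_seq size_rem // size_colors_of.
  by rewrite !size_rem // size_colors_of -subn2.
rewrite (@size_colorings_full 3) ?(perm_mem ps) ?mem_cat ?rs ?orbT //.
case/allpairsPdep: rs => c [[d' e']] [_ /allpairsPdep[d [e [dU eU [-> ->]]]] ->].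
have u1 := uniq_colors_of 1 ms.
have cd : c \notin [:: d; e].
  move: dU eU; rewrite !mem_rem_uniq ?rem_uniq // !inE mem_rem_uniq // inE.
  by rewrite ![_ == c]eq_sym => /andP[/negPf -> _] /and3P[_ /negPf -> _].
have de : d \notin [:: e].
  by move: eU; rewrite mem_rem_uniq ?rem_uniq // !inE eq_sym => /andP[].
rewrite !(@class_sum_cat_nseq _ 0 c [:: d; e]) // !(@class_sum_cat_nseq _ 0 d [:: e]) //.
by rewrite !(@class_sum_nseq _ 0) !subn0.
Qed.

End Step.

(** The [n2] classes of size 2 are assigned to distinct pairs among the [a] parts of size 2, and the
    [n1] single colors are placed on the remaining vertices in any order. *)
Definition count_ones_twos (a b n1 n2 n3 n4 : nat) : nat :=
  [&& n1 + n2.*2 == a.*2 + b, n3 == 0 & n4 == 0] * ('C(a, n2) * n2`! * n1`!).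

Lemma class_sum_eq0 (ms : seq nat) :
  class_count 1 ms = 0 -> class_count 2 ms = 0 -> class_count 3 ms = 0 ->
  class_big ms = 0 -> ms = [::].
Proof.
move=> H1 H2 H3 H4; case: ms H1 H2 H3 H4 => // c ms.
set s := c :: ms => H1 H2 H3 H4; exfalso.
have cs : c \in undup s by rewrite mem_undup mem_head.
have c0 : 0 < count_mem c s by rewrite -has_count has_pred1 mem_head.
have ex phi : class_sum phi s = 0 -> phi (count_mem c s) = 0.
  by rewrite /class_sum => /eqP; rewrite sum_nat_seq_eq0 => /allP/(_ c cs)/eqP.
move: (ex _ H1) (ex _ H2) (ex _ H3) (ex _ H4).
by case: (count_mem c s) c0 => [|[|[|[|?]]]].
Qed.

(** The case of a new pair filled by one class of size 2; [sub_two_term] is that of two single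
    colors, and Pascal's rule adds them. *)
Lemma pred_double_term a b n1 n2 :
  n2 * ((n1 + n2.-1.*2 == a.*2 + b) * ('C(a, n2.-1) * n2.-1`! * n1`!)) =
  (n1 + n2.*2 == a.+1.*2 + b) * ((0 < n2) * 'C(a, n2.-1) * n2`! * n1`!).
Proof.
case: n2 => [|n2]; first by rewrite !mul0n muln0.
have -> : (n1 + n2.+1.*2 == a.+1.*2 + b) = (n1 + n2.*2 == a.*2 + b).
  by rewrite !doubleS !addnS !addSn !eqSS.
by rewrite /= factS mul1n; ring.
Qed.

Lemma sub_two_term a b n1 n2 :
  n1 * n1.-1 * ((n1 - 2 + n2.*2 == a.*2 + b) * ('C(a, n2) * n2`! * (n1 - 2)`!)) =
  (n1 + n2.*2 == a.+1.*2 + b) * ('C(a, n2) * n2`! * n1`!).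
Proof.
case: n1 => [|[|n1]].
(* With fewer than two single colors the total forces [n2 > a], so the right side vanishes as
   well. *)
- rewrite !mul0n; case: eqP => E; last by rewrite mul0n.
  by rewrite bin_small ?muln0 //; lia.
- rewrite muln0 !mul0n; case: eqP => E; last by rewrite mul0n.
  by rewrite bin_small ?muln0 //; lia.
have -> : (n1.+2 + n2.*2 == a.+1.*2 + b) = (n1 + n2.*2 == a.*2 + b).
  by rewrite !doubleS !addSn !eqSS.
by rewrite subn2 /= !factS; ring.
Qed.

Lemma size_colorings_ones_twos a b ms :
  size (colorings (nseq a 2 ++ nseq b 1) ms) = profile_fun (count_ones_twos a b) ms.
Proof.
elim: a ms => [|a IH] ms.
  elim: b ms => [|b IHb] ms.
    case: ms => [|c ms] /=.
      by rewrite /profile_fun !class_sum_nil.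
    rewrite /profile_fun /count_ones_twos.
    case: and3P => // -[/eqP E /eqP n3 /eqP n4].
    have n1 : class_count 1 (c :: ms) = 0 by lia.
    have n2 : class_count 2 (c :: ms) = 0 by lia.
    by have := class_sum_eq0 n1 n2 n3 n4.
  rewrite [nseq 0 2 ++ _]/= (size_colorings1 (IHb : forall ms, size (colorings (nseq b 1) ms) = _)).
  rewrite /profile_fun /count_ones_twos.
  set n1 := class_count 1 ms; set n2 := class_count 2 ms.
  case: n1 => [|n1] /=.
    by rewrite mul0n; case: n2 => [|n2] //=; rewrite ?muln0 ?mul0n ?muln0 // andbF.
  rewrite addSn addnS eqSS; case: [&& _, _ & _]; rewrite ?mul0n ?muln0 // !mul1n.
  by rewrite factS; ring.
rewrite [nseq _ _ ++ _]/= (size_colorings2 IH) /profile_fun /count_ones_twos.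
set n1 := class_count 1 ms; set n2 := class_count 2 ms.
case: (class_count 3 ms == 0); rewrite /= ?andbF ?mul0n ?muln0 //.
case: (class_big ms == 0); rewrite /= ?andbF ?mul0n ?muln0 // !andbT.
rewrite pred_double_term sub_two_term -mulnDr; congr (_ * _).
rewrite -!mulnDl; congr (_ * _ * _).
by case: n2 => [|n2]; rewrite ?bin0 //= mul1n binS addnC.
Qed.

(** The part 3 takes the class of size 3 if there is one. Otherwise it takes three single colors, or
    a pair and a single color in 3 arrangements; these are the two binomial terms. *)
Lemma size_colorings_three_twos a ms :
  size (colorings (3 :: nseq a 2) ms) =
  (class_big ms == 0) *
  match class_count 3 ms with
  | 0 => (class_count 1 ms + (class_count 2 ms).*2 == a.*2 + 3) *
     (('C(a, class_count 2 ms) +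
       3 * ((0 < class_count 2 ms) * 'C(a, (class_count 2 ms).-1))) *
      (class_count 2 ms)`! * (class_count 1 ms)`!)
  | 1 => (class_count 1 ms + (class_count 2 ms).*2 == a.*2) *
     ('C(a, class_count 2 ms) * (class_count 2 ms)`! * (class_count 1 ms)`!)
  | _ => 0
  end.
Proof.
have IH := size_colorings_ones_twos a 0; rewrite cats0 in IH.
rewrite (size_colorings3 IH) /count_ones_twos.
set n1 := class_count 1 ms; set n2 := class_count 2 ms.
case: (class_big ms == 0); rewrite /= ?andbF ?mul0n ?muln0 // !andbT mul1n addn0.
case: (class_count 3 ms) => [|[|n3]] /=; rewrite ?andbF ?mul0n ?muln0 ?andbT ?add0n ?addn0 //; last first.
  by rewrite mul1n.
rewrite mulnDl mulnDl mulnDr addnC; congr (_ + _).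
  case: n1 => [|[|[|n1]]].
  - rewrite !mul0n; case: eqP => E; last by rewrite mul0n.
    by rewrite bin_small ?muln0 //; lia.
  - rewrite ?mul0n ?muln0 ?mul0n; case: eqP => E; last by rewrite mul0n.
    by rewrite bin_small ?muln0 //; lia.
  - rewrite ?muln0 ?mul0n; case: eqP => E; last by rewrite mul0n.
    by rewrite bin_small ?muln0 //; lia.
  have -> : (n1.+3 + n2.*2 == a.*2 + 3) = (n1 + n2.*2 == a.*2).
    by rewrite addnC !addnS addn0 addnC.
  by rewrite !subSS !subn0 /= !factS; ring.
case: n2 => [|n2]; first by rewrite !mul0n muln0.
case: n1 => [|n1].
  have -> : (0 + n2.+1.*2 == a.*2 + 3) = false by lia.
  by rewrite !muln0.
have -> : (n1.+1 + n2.+1.*2 == a.*2 + 3) = (n1 + n2.*2 == a.*2).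
  by rewrite doubleS !addnS !addSn addn0 !eqSS.
by rewrite /= !factS; ring.
Qed.

(** * Coefficients of the Schur functions *)

(* The coefficient of [X^q] in [X^j (1 + X)^N], that is, of a monomial with
   [j] squares and [N] linear factors in [e_(2j+N-q) e_q]. *)
Definition bcoef (j N q : nat) : nat := if j <= q then 'C(N, q - j) else 0.

Lemma bcoefSS j N q : bcoef j.+1 N q.+1 = bcoef j N q.
Proof. by rewrite /bcoef ltnS subSS. Qed.

Lemma bcoefS0 j N : bcoef j.+1 N 0 = 0.
Proof. by []. Qed.

Lemma bcoef_addr j N q : bcoef j N.+1 q.+1 = bcoef j N q.+1 + bcoef j N q.
Proof.
rewrite /bcoef; have [jq|] := leqP j q; first by rewrite (leqW jq) subSn // binS.
rewrite leq_eqVlt => /orP[/eqP <-|qj]; first by rewrite leqnn subnn !bin0.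
by rewrite leqNgt qj.
Qed.

Lemma bcoef_add0 j N : bcoef j N.+1 0 = bcoef j N 0.
Proof. by rewrite /bcoef; case: j => //=; rewrite !bin0. Qed.

Lemma bcoef_sym j N i i' : i + i' = j.*2 + N -> bcoef j N i = bcoef j N i'.
Proof.
rewrite /bcoef => E; have [ji|ij] := leqP j i; have [ji'|ij'] := leqP j i' => //.
- by rewrite -bin_sub; [congr 'C(_, _)|]; lia.
- by apply: bin_small; lia.
- by apply/esym/bin_small; lia.
Qed.

Local Open Scope ring_scope.

(* The coefficient of [X^q] in [(1 - X) X^j (1 + X)^N]. *)
Definition rcoef (j N q : nat) : int :=
  (bcoef j N q)%:Z - (if q is q'.+1 then bcoef j N q' else 0%N)%:Z.

Lemma rcoefSS j N q : rcoef j.+1 N q.+1 = rcoef j N q.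
Proof. by rewrite /rcoef !bcoefSS; case: q => // q; rewrite bcoefSS. Qed.

Lemma rcoefS0 j N : rcoef j.+1 N 0 = 0.
Proof. by []. Qed.

Lemma rcoef_addr j N q : rcoef j N.+1 q.+1 = rcoef j N q.+1 + rcoef j N q.
Proof.
rewrite /rcoef; case: q => [|q]; rewrite ?bcoef_add0 !bcoef_addr; lia.
Qed.

Lemma rcoef_add0 j N : rcoef j N.+1 0 = rcoef j N 0.
Proof. by rewrite /rcoef bcoef_add0. Qed.

(** [(1 - X) X^j (1 + X)^N] is antisymmetric, so its middle coefficient is 0. It belongs to a second
    column longer by 1 than the first, where there is no tableau: the boundary value of the ballot
    recursion. *)
Lemma rcoef_mid j N q : (q.*2.+1 = j.*2 + N)%N -> rcoef j N q.+1 = 0.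
Proof. by move=> E; rewrite /rcoef (@bcoef_sym j N q.+1 q) ?subrr //; lia. Qed.

Definition nlattice p q u ms := size (lattice_words p q u ms).

Lemma nlattice_cons p q u m ms : nlattice p q u (m :: ms) =
  if (u <= q <= p)%N then
    (\sum_(x <- letters p q u m) nlattice (p - x.1.1) (q - x.1.2) (u - x.2) ms)%N
  else 0%N.
Proof.
rewrite /nlattice /=; case: ifP => // _.
by rewrite size_allpairs_dep sumnE big_map.
Qed.

Lemma nlattice_dom p q u ms : ~~ (u <= q <= p)%N -> nlattice p q u ms = 0%N.
Proof.
case: ms => [|m ms] H; last by rewrite nlattice_cons (negPf H).
by rewrite /nlattice /=; case: and3P => // -[/eqP p0 /eqP q0 /eqP u0]; rewrite p0 q0 u0 in H.
Qed.

Definition big_part (ms : seq nat) := count (leq 4) ms.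

(** The largest color is removed from one column, a factor [1 + X], or from both, a factor [X]. The
    factor [1 - X] is the reflection term of the ballot condition; [rcoef_mid] settles the
    boundary. *)
Lemma nlattice0 p q ms : all (leq 1) ms ->
  (nlattice p q 0 ms)%:Z =
    if [&& q <= p, p + q == sumn ms, count_mem 3 ms == 0 & big_part ms == 0]%N
    then rcoef (count_mem 2 ms) (count_mem 1 ms) q else 0.
Proof.
elim: ms p q => [|m ms IH] p q /=.
  by move=> _; rewrite /nlattice /= andbT addn_eq0; case: p q => [|p] [|q]; rewrite //= andbF.
case/andP => m0 ms1; rewrite nlattice_cons.
have [qp|_] := leqP q p; last by rewrite andbF.
have sumE : count_mem 3 ms = 0%N -> big_part ms = 0%N ->
    sumn ms = ((count_mem 2 ms).*2 + count_mem 1 ms)%N.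
  elim: ms ms1 {IH} => //= d ms IH /andP[d0 /IH{}IH].
  case: d d0 => [|[|[|[|d]]]] //= _; lia.
case: m m0 => [|[|[|[|m]]]] // _; rewrite /= ?add0n ?add1n.
- case: p qp => [|p]; case: q => [|q] // qp; rewrite /letters /= ?big_nil //.
    by rewrite big_seq1 /= !subn0 subn1 IH //= !addn0 rcoef_add0 eqSS.
  rewrite big_cons big_seq1 /= !subn0 !subn1 /= PoszD !IH // (ltnW qp) andTb rcoef_addr.
  have -> : (p.+1 + q.+1 == (sumn ms).+1)%N = (p + q.+1 == sumn ms)%N by [].
  have -> : (p.+1 + q)%N = (p + q.+1)%N by rewrite addSnnS.
  case: (ltnP q p) => [_|pq]; rewrite ?andTb ?andFb ?add0r.
    by case: ifP => // _; rewrite addr0.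
  case: ifP => // /and3P[/eqP S /eqP t0 /eqP s0].
  have mid : (q.*2.+1 = (count_mem 2 ms).*2 + count_mem 1 ms)%N.
    by move: S; rewrite sumE //; lia.
  by rewrite (rcoef_mid mid) add0r.
- case: p qp => [|p]; case: q => [|q] // qp; rewrite /letters /= ?big_nil //.
  + by rewrite rcoefS0; case: ifP.
  rewrite big_seq1 /= !subn0 !subn1 IH //= rcoefSS.
  have -> : (p.+1 + q.+1 == 2 + sumn ms)%N = (p + q == sumn ms)%N by rewrite addSn addnS.
  by have -> : (q <= p)%N by [].
- by case: p qp => [|p]; case: q => [|q] // qp; rewrite /letters /= ?big_nil // andbF.
by rewrite !andbF; case: p qp => [|p]; case: q => [|q] // qp; rewrite /letters /= ?big_nil.
Qed.

(* The coefficient at a monomial with [t] cubes of the Schur function whose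
   columns have heights [p >= q.+1 >= 1]. *)
Definition vcoef (p j N t q : nat) : int :=
  match t with
  | 0 => q.+1%:Z * (bcoef j N q.+2)%:Z - p.+1%:Z * (bcoef j N q)%:Z
  | 1 => rcoef j N q
  | _ => 0
  end.

(** [vcoef] is the value of the dual Jacobi-Trudi determinant. The proof checks the recursion
    instead: once the largest color removes the single cell of the third column, two columns are
    left and [nlattice0] applies. *)
Lemma nlattice1 p q ms : all (leq 1) ms ->
  (nlattice p q.+1 1 ms)%:Z =
    if [&& q < p, p + q.+2 == sumn ms & big_part ms == 0]%N then
      vcoef p (count_mem 2 ms) (count_mem 1 ms) (count_mem 3 ms) q
    else 0.
Proof.
elim: ms p q => [|m ms IH] p q /=.
  by move=> _; rewrite /nlattice /= !andbF addnS andbF.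
case/andP => m0 ms1; rewrite nlattice_cons.
have [qp|_] := ltnP q p; last by rewrite andbF.
have sumE : big_part ms = 0%N ->
    sumn ms = ((count_mem 3 ms) * 3 + (count_mem 2 ms).*2 + count_mem 1 ms)%N.
  elim: ms ms1 {IH} => //= d ms IH /andP[d0 /IH{}IH].
  case: d d0 => [|[|[|[|d]]]] //= _; lia.
case: p qp => // p qp.
have q10 : (0 < q.+1 <= p.+1)%N by [].
set j := count_mem 2 ms in sumE *; set N := count_mem 1 ms in sumE *.
set t := count_mem 3 ms in sumE *.
case: m m0 => [|[|[|[|m]]]] // _; rewrite /= ?add0n ?add1n.
- rewrite /letters /= !big_cons big_nil /= !subn0 !subn1 /= addn0.
  have -> : (p.+1 + q.+2 == (sumn ms).+1)%N = (p + q.+2 == sumn ms)%N by [].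
  rewrite !PoszD nlattice0 // [(q < p.+1)%N]qp andTb.
  have -> : (p.+1 + q.+1)%N = (p + q.+2)%N by rewrite addSnnS.
  have -> : (nlattice p q.+1 1 ms)%:Z =
      if (p + q.+2 == sumn ms)%N && (big_part ms == 0%N) then vcoef p j N t q else 0.
    rewrite IH //; case: ltnP => // pq; rewrite andFb; case: ifP => // /andP[/eqP S /eqP s0].
    have {pq}E : q = p by lia.
    move: (sumE s0); rewrite -S E; case: t {sumE S} => [|[|t]] // S.
      by rewrite /vcoef (@bcoef_sym j N p.+2 p) ?subrr //; lia.
    case: p {IH qp q10 E} S => [|p] S; first by lia.
    by rewrite /vcoef rcoef_mid //; lia.
  have -> : (nlattice p.+1 q 1 ms)%:Z =
      if (p + q.+2 == sumn ms)%N && (big_part ms == 0%N) then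
        if q is q'.+1 then vcoef p.+1 j N t q' else 0 else 0.
    case: q {q10} qp => [|q] qp; first by rewrite nlattice_dom //; case: ifP.
    by rewrite IH // (ltnW qp) andTb addSnnS.
  have -> : [&& p + q.+2 == sumn ms, t == 0 & big_part ms == 0]%N =
            ((p + q.+2 == sumn ms) && (big_part ms == 0) && (t == 0))%N.
    by rewrite -!andbA; congr andb; rewrite andbC.
  case: (_ && (big_part ms == 0%N)); last by rewrite /= !addr0.
  rewrite andTb; case: t {sumE} => [|[|t]] /=.
  + case: q {qp q10} => [|q]; rewrite /rcoef !bcoef_addr ?bcoef_add0 ?bcoef_addr !PoszD;
      rewrite -?[p.+2]addn1 -?[q.+2]addn1 -?[p.+1]addn1 -?[q.+1]addn1 !PoszD; ring.
  + by case: q {qp q10} => [|q]; rewrite ?rcoef_addr ?rcoef_add0 !addr0.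
  + by case: q {qp q10} => [|q]; rewrite !addr0.
- rewrite /letters /= !big_cons big_nil /= !subn0 !subn1 /= addn0.
  have -> : (p.+1 + q.+2 == 2 + sumn ms)%N = (p + q.+1 == sumn ms)%N by rewrite !addSn addnS.
  rewrite !PoszD !nlattice0 // [(q <= p.+1)%N]ltnW // andTb.
  have -> : (p.+1 + q)%N = (p + q.+1)%N by rewrite addSnnS.
  have -> : (nlattice p q 1 ms)%:Z =
      if (p + q.+1 == sumn ms)%N && (big_part ms == 0%N) then
        if q is q'.+1 then vcoef p j N t q' else 0 else 0.
    case: q {q10} qp => [|q] qp; first by rewrite nlattice_dom //; case: ifP.
    by rewrite IH // -ltnS qp.
  have c3 : [&& p + q.+1 == sumn ms, t == 0 & big_part ms == 0]%N =
            ((p + q.+1 == sumn ms) && (big_part ms == 0) && (t == 0))%N.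
    by rewrite -!andbA; congr andb; rewrite andbC.
  have -> : (if [&& q < p, p + q.+1 == sumn ms, t == 0 & big_part ms == 0]%N
             then rcoef j N q.+1 else 0) =
            (if [&& p + q.+1 == sumn ms, t == 0 & big_part ms == 0]%N
             then rcoef j N q.+1 else 0).
    case: (ltnP q p) => // pq; rewrite andFb; case: ifP => // /and3P[/eqP S /eqP t0 /eqP s0].
    by move: (sumE s0) pq; rewrite t0 -S => S' pq; rewrite rcoef_mid //; lia.
  rewrite c3; case: (_ && (big_part ms == 0%N)); last by rewrite /= !addr0.
  rewrite andTb; case: t {sumE c3} => [|[|t]] /=.
  + case: q {qp q10} => [|q]; rewrite /rcoef !bcoefSS ?bcoefS0;
      rewrite -?[p.+2]addn1 -?[q.+2]addn1 -?[p.+1]addn1 -?[q.+1]addn1 !PoszD; ring.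
  + by case: q {qp q10} => [|q]; rewrite ?rcoefSS ?rcoefS0 !addr0.
  + by case: q {qp q10} => [|q]; rewrite !addr0.
- rewrite /letters /= !big_cons big_nil /= !subn1 /= addn0 nlattice0 //.
  have -> : (p.+1 + q.+2 == 3 + sumn ms)%N = (p + q == sumn ms)%N by rewrite !addSn !addnS.
  rewrite -ltnS qp andTb; case: (p + q == _)%N => //=.
  by rewrite -/t; case: (big_part ms == 0%N); rewrite ?andbF ?andbT //; case: t {sumE}.
by rewrite /letters /= big_nil andbF.
Qed.

(** * Differences of factorials *)

(* The [p]-th forward difference of the factorial at [N]. *)
Fixpoint dfact (p N : nat) : int :=
  if p is p'.+1 then dfact p' N.+1 - dfact p' N else (N`!)%:Z.

(** For [N = 0] this is the recurrence of the derangement numbers. Its coefficients are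
    non-negative, and so are the differences. *)
Lemma dfactSS p N :
  dfact p.+2 N = (N + p.+1)%:Z * dfact p.+1 N + p.+1%:Z * dfact p N.
Proof.
elim: p N => [|p IH] N; first by rewrite /= !factS; lia.
have E q M : dfact q.+1 M = dfact q M.+1 - dfact q M by [].
have e1 : dfact p N.+1 = dfact p.+1 N + dfact p N by rewrite E subrK.
have e2 : dfact p.+1 N.+1 = dfact p.+2 N + dfact p.+1 N by rewrite (E p.+1) subrK.
rewrite (E p.+2) (IH N.+1) e2 (IH N) e1 addSn.
rewrite -?[p.+2]addn1 -?[p.+1]addn1 -?[N.+1]addn1 !PoszD; ring.
Qed.

Lemma dfact1 N : dfact 1 N = N%:Z * (N`!)%:Z.
Proof. by rewrite /= factS; lia. Qed.

Lemma dfact_ge0 p N : 0 <= dfact p N.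
Proof.
suff: 0 <= dfact p N /\ 0 <= dfact p.+1 N by case.
elim: p => [|p [IH0 IH1]]; first by rewrite dfact1.
by split=> //; rewrite dfactSS addr_ge0 ?mulr_ge0.
Qed.

Lemma dfact_sum p N :
  dfact p N = \sum_(0 <= i < p.+1) (-1) ^+ i * ('C(p, i))%:Z * ((N + p - i)`!)%:Z.
Proof.
elim: p N => [|p IH] N.
  by rewrite big_nat1 bin0 mulr1 mul1r addn0 subn0.
rewrite /= !IH; rewrite [in RHS]big_nat_recl // bin0 expr0 !mul1r subn0.
rewrite [X in X - _]big_nat_recl // bin0 expr0 !mul1r subn0 addSnnS -addrA; congr (_ + _).
rewrite (eq_bigr (fun i => (-1) ^+ i.+1 * ('C(p, i.+1))%:Z * ((N + p - i)`!)%:Z)); last first.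
  by move=> i _; rewrite addnS subSS.
rewrite [RHS](eq_bigr (fun i => (-1) ^+ i.+1 * ('C(p, i.+1))%:Z * ((N + p - i)`!)%:Z
     - (-1) ^+ i * ('C(p, i))%:Z * ((N + p - i)`!)%:Z)); last first.
  move=> i _; rewrite addnS subSS binS PoszD exprS; ring.
rewrite sumrB; congr (_ - _).
by rewrite [RHS]big_nat_recr //= bin_small // mulr0 mul0r addr0.
Qed.

Lemma rcoef0 n t : rcoef 0 n t.+1 = ('C(n, t.+1))%:Z - ('C(n, t))%:Z.
Proof. by rewrite /rcoef /bcoef /= !subn0. Qed.

(** The sum is needed for [T = s + 1], where it vanishes because [s ^_ T] does; the closed form of
    all partial sums makes an induction possible. *)
Lemma alternating_partial_sum s n T : (T + s.+1 <= n)%N ->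
  \sum_(0 <= t < T.+1) (-1) ^+ t * (s.+1 ^_ t)%:Z * ((n - t - s.+1)`!)%:Z * rcoef 0 n t
  = (-1) ^+ T * (s ^_ T)%:Z * ((n - T - s.+1)`!)%:Z * ('C(n, T))%:Z.
Proof.
elim: T => [|T IH] le; first by rewrite big_nat1 !ffactn0 /rcoef /bcoef /= !bin0 !subr0.
rewrite big_nat_recr //= IH; last by lia.
have -> : (n - T - s.+1 = (n - T.+1 - s.+1).+1)%N by lia.
set m := (n - T.+1 - s.+1)%N; rewrite rcoef0 factS.
have nE : n = (m + T + s.+2)%N by rewrite /m; lia.
have b := mul_bin_left n T; have {}b : (T.+1%:Z * ('C(n, T.+1))%:Z = (n - T)%N%:Z * ('C(n, T))%:Z).
  by rewrite -!PoszM b.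
have nT : (n - T)%N%:Z = m%:Z + s%:Z + 2 by lia.
rewrite nT in b; rewrite (ffactnSr s T) exprS.
have [Ts|sT] := leqP T s.
  rewrite (_ : s.+1 ^_ T.+1 = s.+1 * s ^_ T)%N; last by rewrite ffactSS.
  have sT : (s - T)%N%:Z = s%:Z - T%:Z by lia.
  rewrite !PoszM sT; move: b.
  move: ('C(n, T)) ('C(n, T.+1)) (s ^_ T) (m`!) ((-1) ^+ T : int) => X Y f g e b.
  rewrite -[m.+1]addn1 -[s.+1]addn1 !PoszD.
  have b' : T%:Z * Y%:Z = (m%:Z + s%:Z + 2) * X%:Z - Y%:Z.
    by rewrite -b -[T.+1]addn1 PoszD; ring.
  transitivity (e * f%:Z * g%:Z * ((m%:Z + 1) * X%:Z - (s%:Z + 1) * (Y%:Z - X%:Z))); first by ring.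
  transitivity (e * f%:Z * g%:Z * (T%:Z * Y%:Z - s%:Z * Y%:Z)); last by ring.
  rewrite b'; ring.
have -> : (s ^_ T = 0)%N by apply: ffact_small.
have -> : (s.+1 ^_ T.+1 = 0)%N by apply: ffact_small; lia.
by rewrite !mul0n !mulr0 !mul0r addr0.
Qed.

Lemma sign_subn s t : (t <= s)%N -> (-1) ^+ (s - t) = (-1) ^+ s * (-1) ^+ t :> int.
Proof.
by move=> ts; rewrite -{2}(subnK ts) exprD -mulrA -exprD addnn -mul2n exprM sqrrN !expr1n mulr1.
Qed.

Lemma alternating_sum s n : (s.*2 <= n)%N ->
  \sum_(0 <= t < s.+1) (-1) ^+ (s - t) * (s ^_ t)%:Z * ((n - t - s)`!)%:Z * rcoef 0 n t
  = (s == 0%N)%:Z * (n`!)%:Z.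
Proof.
case: s => [|s] le; first by rewrite big_nat1 /= /rcoef /bcoef /= ffactn0 !bin0 !subn0 mulr1 mul1r.
rewrite mul0r.
transitivity ((-1) ^+ s.+1 * \sum_(0 <= t < s.+2) (-1) ^+ t * (s.+1 ^_ t)%:Z *
    ((n - t - s.+1)`!)%:Z * rcoef 0 n t).
  rewrite mulr_sumr big_nat_cond [RHS]big_nat_cond; apply: eq_bigr => t /andP[/andP[_ ts] _].
  by rewrite sign_subn // !mulrA.
by rewrite alternating_partial_sum ?ffact_small // ?mulr0 ?mul0r ?mulr0 //; lia.
Qed.

(** The coefficient of [s_(2^k 1^(2a+b-2k))] in the chromatic function of [K_(2^a, 1^b)]. Passing
    from [(a, k)] to [(a + 1, k + 1)] multiplies it by [a + 1], as cancelling a square requires, so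
    all is determined by the values at [k = 0]. *)
Definition ccoef (a b k : nat) : int := (a ^_ k)%:Z * dfact (a - k) (a - k + b).

Lemma ccoef_ge0 a b k : 0 <= ccoef a b k.
Proof. by rewrite mulr_ge0 ?dfact_ge0. Qed.

Lemma sum_nat_lower (s a : nat) (F : nat -> int) : (s <= a)%N ->
  \sum_(k < a.+1 | (k <= s)%N) F k = \sum_(0 <= k < s.+1) F k.
Proof.
move=> sa; rewrite -(big_mkord (fun k => (k <= s)%N)) (big_cat_nat (n := s.+1)) //=.
rewrite [X in _ + X]big_nat_cond [X in _ + X]big_pred0 ?addr0; last first.
  by move=> k; case: (leqP k s); rewrite ?andbF ?andbT // => ks; rewrite ltnNge ks.
rewrite big_nat_cond [RHS]big_nat_cond; apply: eq_bigl => k.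
by rewrite ltnS andbT andbb.
Qed.

Lemma sum_nat_upper (k a : nat) (F : nat -> int) : (k <= a)%N ->
  \sum_(s < a.+1 | (k <= s)%N) F s = \sum_(0 <= i < (a - k).+1) F (i + k)%N.
Proof.
move=> ka; rewrite -(big_mkord (fun s => (k <= s)%N)) (big_cat_nat (n := k)) ?leqW //=.
rewrite [X in X + _]big_nat_cond [X in X + _]big_pred0 ?add0r; last first.
  by move=> s; case: leqP; rewrite ?andbF.
rewrite -[X in bigop _ (index_iota X _) _]add0n big_addn subSn //.
by rewrite big_mkcond; apply: eq_bigr => i _; rewrite leq_addl.
Qed.

(** With [dfact] expanded over [i], the terms are grouped by [s = k + i]. Each inner sum is an
    [alternating_sum], and only [s = 0] survives. *)
Lemma sum_ccoef0 a b N : (N = a.*2 + b)%N ->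
  \sum_(k < a.+1) ccoef a b k * rcoef 0 N k = (N`!)%:Z.
Proof.
move=> NE.
transitivity (\sum_(k < a.+1) \sum_(s < a.+1 | (k <= s)%N)
   ('C(a, s))%:Z * ((-1) ^+ (s - k) * (s ^_ k)%:Z * ((N - k - s)`!)%:Z * rcoef 0 N k)).
  apply: eq_bigr => k _; rewrite /ccoef dfact_sum.
  have ka : (k <= a)%N by rewrite -ltnS.
  rewrite (sum_nat_upper (fun s => ('C(a, s))%:Z * ((-1) ^+ (s - k) * (s ^_ k)%:Z *
     ((N - k - s)`!)%:Z * rcoef 0 N k))) // mulr_sumr mulr_suml.
  rewrite [RHS]big_nat_cond [LHS]big_nat_cond; apply: eq_bigr => i /andP[/andP[_ ia] _].
  rewrite addnK.
  have -> : (a - k + b + (a - k) - i = N - k - (i + k))%N by lia.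
  have E : ((a ^_ k) * 'C(a - k, i) = 'C(a, i + k) * ((i + k) ^_ k))%N.
    apply/eqP; rewrite -(eqn_pmul2r (fact_gt0 i)) -(eqn_pmul2r (fact_gt0 (a - k - i))).
    have -> : (a ^_ k * 'C(a - k, i) * i`! * (a - k - i)`! = a`!)%N.
      by rewrite -!mulnA bin_fact ?ffact_fact //; lia.
    have -> : ('C(a, i + k) * (i + k) ^_ k * i`! * (a - k - i)`! = 'C(a, i+k) * ((i + k)`! * (a - (i + k))`!))%N.
      by rewrite -(ffact_fact (leq_addl i k)) addnK -!mulnA subnDA addnC subnAC.
    by rewrite bin_fact //; lia.
  transitivity ((-1) ^+ i * (a ^_ k * 'C(a - k, i))%N%:Z * ((N - k - (i + k))`!)%:Z * rcoef 0 N k).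
    by rewrite PoszM; ring.
  by rewrite E PoszM; ring.
rewrite (exchange_big_dep xpredT) //=.
rewrite big_ord_recl [X in _ + X]big1 /= ?addr0 => [|s _].
  rewrite (eq_bigl (fun k : 'I_a.+1 => k == ord0)) => [|k]; last by rewrite leqn0.
  by rewrite big_pred1_eq bin0 ffactn0 /rcoef /bcoef /= !bin0 !subn0 !mul1r mulr1.
have sa : (s.+1 <= a)%N by exact: ltn_ord.
rewrite /bump leq0n add1n -mulr_sumr (sum_nat_lower (fun k => (-1) ^+ (s.+1 - k) * (s.+1 ^_ k)%:Z *
   ((N - k - s.+1)`!)%:Z * rcoef 0 N k)) //.
by rewrite alternating_sum ?mul0r ?mulr0 //; lia.
Qed.

Lemma sum_ccoef a b j N : (j.*2 + N = a.*2 + b)%N ->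
  \sum_(k < a.+1) ccoef a b k * rcoef j N k = ('C(a, j) * j`! * N`!)%:Z.
Proof.
elim: j a => [|j IH] a E.
  by rewrite sum_ccoef0 ?bin0 ?mul1n // -E.
case: a E => [|a] E; first by rewrite big_ord1 rcoefS0 mulr0.
rewrite big_ord_recl rcoefS0 mulr0 add0r.
transitivity (a.+1%:Z * \sum_(k < a.+1) ccoef a b k * rcoef j N k).
  rewrite mulr_sumr; apply: eq_bigr => k _.
  by rewrite /ccoef /= rcoefSS ffactSS subSS PoszM; ring.
rewrite IH; last by move: E; rewrite !doubleS; lia.
by rewrite -PoszM factS; congr Posz; rewrite !mulnA mul_bin_diag; ring.
Qed.

Arguments vcoef : simpl never.

(** * The two-column coefficients for [(3, 2^a)] *)

Definition shift1 (f : nat -> int) k := if k is k'.+1 then f k' else 0.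
Definition shift2 (f : nat -> int) k := if k is k'.+2 then f k' else 0.

(* The coefficient of [s_(2^k 1^(2a+3-2k))] in the chromatic function of
   [K_(3, 2^a)]. The terms in [ccoef a 0] compensate the functions
   [s_(3, 2^q, 1^(2a-2q))]: modulo cubes, the Schur function with columns of
   heights [p], [q.+1], [1] equals [q.+1 e_p e_(q+2) - p.+1 e_(p+2) e_q], and
   [e_(n-q) e_q] is the sum of the [s_(2^k 1^(n-2k))] over [k <= q]. *)
Definition tcoef (a k : nat) : int :=
  3 * ccoef a.+1 1 k - 2 * ccoef a 3 k
  - k.-1%:Z * shift2 (ccoef a 0) k - k%:Z * shift1 (ccoef a 0) k
  + \sum_(q < a.+1 | (k <= q)%N) (a.*2.+1%:Z - 2 * q%:Z) * ccoef a 0 q.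

Lemma sum_rcoef_le j N q m : (q < m)%N ->
  \sum_(k < m | (k <= q)%N) rcoef j N k = (bcoef j N q)%:Z.
Proof.
case: m => // m qm; rewrite sum_nat_lower // {m qm}.
elim: q => [|q IH]; first by rewrite big_nat1 /rcoef subr0.
by rewrite big_nat_recr //= IH /rcoef; lia.
Qed.

(** The first summand consists of two-column Schur functions, which [tcoef] has to subtract; the
    second is a negative multiple of a product of two elementary functions, and compensating it
    gives the non-negative last sum of [tcoef]. *)
Lemma vcoef_rcoef a j N q : (q <= a)%N ->
  vcoef (a.*2.+1 - q) j N 0 q =
  q.+1%:Z * (rcoef j N q.+2 + rcoef j N q.+1) - (a.*2.+1%:Z - 2 * q%:Z) * (bcoef j N q)%:Z.
Proof.
move=> qa; rewrite /vcoef /rcoef.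
have -> : (a.*2.+1 - q).+1%:Z = a.*2.+1%:Z - q%:Z + 1 by lia.
rewrite -[q.+1]addn1 PoszD; ring.
Qed.

Lemma ccoef_gt a b k : (a < k)%N -> ccoef a b k = 0.
Proof. by move=> ak; rewrite /ccoef ffact_small // mul0r. Qed.

Lemma sum_tcoef a j N : (j.*2 + N = a.*2 + 3)%N ->
  \sum_(k < a.+2) tcoef a k * rcoef j N k +
  \sum_(q < a.+1) ccoef a 0 q * vcoef (a.*2.+1 - q) j N 0 q =
  3 * ('C(a.+1, j) * j`! * N`!)%N%:Z - 2 * ('C(a, j) * j`! * N`!)%N%:Z.
Proof.
(* At the middle index [a + 2] the coefficient vanishes; adding this index makes room for the shift
   by 2. *)
move=> E; have Rtop : rcoef j N a.+2 = 0 by rewrite rcoef_mid // E; lia.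
have -> : \sum_(k < a.+2) tcoef a k * rcoef j N k = \sum_(k < a.+3) tcoef a k * rcoef j N k.
  by rewrite [RHS]big_ord_recr /= Rtop mulr0 addr0.
have E1 : \sum_(k < a.+3) ccoef a.+1 1 k * rcoef j N k = ('C(a.+1, j) * j`! * N`!)%N%:Z.
  by rewrite big_ord_recr /= Rtop mulr0 addr0 sum_ccoef // E; lia.
have E3 : \sum_(k < a.+3) ccoef a 3 k * rcoef j N k = ('C(a, j) * j`! * N`!)%N%:Z.
  by rewrite 2!big_ord_recr /= Rtop mulr0 addr0 (@ccoef_gt a 3 a.+1) // mul0r addr0 sum_ccoef.
have S2 : \sum_(k < a.+3) k.-1%:Z * shift2 (ccoef a 0) k * rcoef j N k =
          \sum_(q < a.+1) q.+1%:Z * ccoef a 0 q * rcoef j N q.+2.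
  by rewrite 2!big_ord_recl /= mulr0 !mul0r !add0r.
have S1 : \sum_(k < a.+3) k%:Z * shift1 (ccoef a 0) k * rcoef j N k =
          \sum_(q < a.+1) q.+1%:Z * ccoef a 0 q * rcoef j N q.+1.
  rewrite big_ord_recl /= !mul0r !add0r [LHS]big_ord_recr /= ccoef_gt //.
  by rewrite mulr0 mul0r addr0.
have S0 : \sum_(k < a.+3) (\sum_(q < a.+1 | (k <= q)%N) (a.*2.+1%:Z - 2 * q%:Z) * ccoef a 0 q) * rcoef j N k =
   \sum_(q < a.+1) (a.*2.+1%:Z - 2 * q%:Z) * ccoef a 0 q * (bcoef j N q)%:Z.
  under eq_bigr do rewrite mulr_suml.
  rewrite (exchange_big_dep xpredT) //=; apply: eq_bigr => q _.
  by rewrite -mulr_sumr sum_rcoef_le //; have := ltn_ord q; lia.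
rewrite -E1 -E3.
have -> : \sum_(k < a.+3) tcoef a k * rcoef j N k =
  3 * (\sum_(k < a.+3) ccoef a.+1 1 k * rcoef j N k) -
  2 * (\sum_(k < a.+3) ccoef a 3 k * rcoef j N k) -
  \sum_(k < a.+3) k.-1%:Z * shift2 (ccoef a 0) k * rcoef j N k -
  \sum_(k < a.+3) k%:Z * shift1 (ccoef a 0) k * rcoef j N k +
  \sum_(k < a.+3) (\sum_(q < a.+1 | (k <= q)%N) (a.*2.+1%:Z - 2 * q%:Z) * ccoef a 0 q) * rcoef j N k.
  rewrite !mulr_sumr -!sumrB -big_split /=; apply: eq_bigr => k _.
  by rewrite /tcoef; ring.
rewrite S2 S1 S0.
have -> : \sum_(q < a.+1) ccoef a 0 q * vcoef (a.*2.+1 - q) j N 0 q =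
    \sum_(q < a.+1) q.+1%:Z * ccoef a 0 q * rcoef j N q.+2 +
    \sum_(q < a.+1) q.+1%:Z * ccoef a 0 q * rcoef j N q.+1 -
    \sum_(q < a.+1) (a.*2.+1%:Z - 2 * q%:Z) * ccoef a 0 q * (bcoef j N q)%:Z.
  rewrite -big_split -sumrB /=; apply: eq_bigr => q _.
  by rewrite vcoef_rcoef; [ring | rewrite -ltnS ltn_ord].
ring.
Qed.

(** These are the first four terms of [tcoef (k + p) k] times [(p + 1)(p + 2)], without their common
    factor [(k + p) ^_ k]. Two estimates suffice: [dfact p.+1 p.+1] is at most [dfact p p.+2], and
    [dfact p.+1 p.+2] is at least [2p + 2] times [dfact p p.+2]. *)
Lemma tcoef_main_ge0 (p k : nat) : (0 <=
  3 * ((k + p).+1%:Z * p.+2%:Z) * dfact p.+1 p.+2 -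
  2 * (p.+1%:Z * p.+2%:Z) * dfact p p.+3 -
  k.-1%:Z * dfact p.+2 p.+2 - k%:Z * p.+2%:Z * dfact p.+1 p.+1 :> int).
Proof.
have e3 : dfact p p.+3 = dfact p.+1 p.+2 + dfact p p.+2 by rewrite /= subrK.
have e2 := dfactSS p p.+2.
have e1 : dfact p.+1 p.+1 <= dfact p p.+2 by rewrite /= gerBl dfact_ge0.
have d0 := dfact_ge0 p p.+2.
have d1 : (p.+1 + p.+1)%N%:Z * dfact p p.+2 <= dfact p.+1 p.+2.
  case: p {e3 e2 e1 d0} => [|p]; first by rewrite dfact1.
  by rewrite [leRHS]dfactSS -(addSnnS p.+2 p.+1) lerDl mulr_ge0 ?dfact_ge0.
rewrite e3 e2 {e3 e2}; move: e1 d0 d1.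
move: (dfact p.+1 p.+2) (dfact p p.+2) (dfact p.+1 p.+1) => D1 D0 E e1 d0 d1.
set P := p%:Z; have P0 : 0 <= P by [].
have -> : p.+2%:Z = P + 2 by lia.
have -> : p.+1%:Z = P + 1 by lia.
have -> : (p.+2 + p.+1)%N%:Z = 2 * P + 3 by lia.
have {}d1 : (2 * P + 2) * D0 <= D1.
  by rewrite (_ : 2 * P + 2 = (p.+1 + p.+1)%N%:Z) //; lia.
have pK : (k + p).+1%:Z = k%:Z + P + 1 by rewrite /P; lia.
move: P P0 d1 pK => {p}P P0 d1 ->.
have [P1 P2 P3] : [/\ 0 <= P + 1, 0 <= P + 2 & 0 <= P + 3] by split; lra.
have PD : 0 <= P * D0 by rewrite mulr_ge0.
have PPD : 0 <= P * (P * D0) by rewrite mulr_ge0.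
have D10 : 0 <= D1 - 2 * D0 by lra.
have c0 : 0 <= (P + 1) * (P + 2) * (D1 - 2 * D0).
  by rewrite !mulr_ge0.
have PE : 0 <= (P + 2) * (D0 - E) by rewrite mulr_ge0 // subr_ge0.
have PD1 : 0 <= (P + 3) * (D1 - (2 * P + 2) * D0).
  by rewrite mulr_ge0 // subr_ge0.
have c1 : 0 <= (P + 3) * D1 - (P + 1) * D0 - (P + 2) * E.
  by lra.
case: k => [|k].
  rewrite /= !mul0r !subr0 add0r.
  have -> : 3 * ((P + 1) * (P + 2)) * D1 - 2 * ((P + 1) * (P + 2)) * (D1 + D0) =
    (P + 1) * (P + 2) * (D1 - 2 * D0) by ring.
  exact: c0.
have -> : k.+1%:Z = k%:Z + 1 by lia.
rewrite /=; have K0 : 0 <= k%:Z by [].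
move: (k%:Z) K0 => K K0.
have c2 : 0 <= K * ((P + 3) * D1 - (P + 1) * D0 - (P + 2) * E) by rewrite mulr_ge0.
have -> : 3 * ((K + 1 + P + 1) * (P + 2)) * D1 - 2 * ((P + 1) * (P + 2)) * (D1 + D0) -
     K * ((2 * P + 3) * D1 + (P + 1) * D0) - (K + 1) * (P + 2) * E =
   K * ((P + 3) * D1 - (P + 1) * D0 - (P + 2) * E) +
   ((P + 3) * D1 - (P + 1) * D0 - (P + 2) * E) +
   (P + 1) * (P + 2) * (D1 - 2 * D0) + ((2 * P + 3) * D1 + (P + 1) * D0) by ring.
have D1p : 0 <= D1 by lra.
have PD1' : 0 <= P * D1 by rewrite mulr_ge0.
by lra.
Qed.

Lemma tcoef_ge0 a k : (k <= a.+1)%N -> 0 <= tcoef a k.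
Proof.
move=> ka; rewrite /tcoef addr_ge0 //; last first.
  apply: sumr_ge0 => q _; rewrite mulr_ge0 ?ccoef_ge0 //.
  by have := ltn_ord q; lia.
(* [k = a + 1] is treated apart, since then no [p] satisfies [a = k + p]. *)
have [{}ka|ka'] := leqP k a; last first.
  have -> : k = a.+1 by lia.
  rewrite (@ccoef_gt a 3) // mulr0 subr0 /shift1 /shift2.
  have -> : ccoef a.+1 1 a.+1 = a.+1%:Z * (a`!)%:Z.
    by rewrite /ccoef ffactnn subnn /= mulr1 factS.
  have -> : ccoef a 0 a = (a`!)%:Z by rewrite /ccoef ffactnn subnn /= mulr1.
  case: a {ka ka'} => [|a] //=.
  have -> : ccoef a.+1 0 a = (a.+1`!)%:Z.
    rewrite /ccoef (_ : a.+1 - a = 1)%N; last by lia.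
    rewrite /= mulr1; congr Posz; have := ffact_fact (leqnSn a).
    by rewrite (_ : a.+1 - a = 1)%N ?muln1 //; lia.
  by have : 0 <= (a.+1`!)%:Z by []; nia.
have [p aE] : exists p, a = (k + p)%N by exists (a - k)%N; lia.
(* In [s1], [s3] and [s4] the factors [p + 1] and [p + 2] turn the falling factorials of [a + 1] of
   order [k], and of [a] of orders [k - 1] and [k - 2], into multiples of [a ^_ k]. *)
have s1 : p.+1%:Z * ccoef a.+1 1 k = (k + p).+1%:Z * (a ^_ k)%:Z * dfact p.+1 p.+2.
  rewrite /ccoef (_ : a.+1 - k = p.+1)%N ?addn1; last by lia.
  rewrite mulrA -!PoszM -aE -ffactSS ffactnSr (_ : a.+1 - k = p.+1)%N; last by lia.
  by rewrite mulnC.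
have s2 : ccoef a 3 k = (a ^_ k)%:Z * dfact p p.+3.
  by rewrite /ccoef (_ : a - k = p)%N ?addn3 //; lia.
have s3 : p.+1%:Z * (k%:Z * shift1 (ccoef a 0) k) = k%:Z * ((a ^_ k)%:Z * dfact p.+1 p.+1).
  case: k {s1 s2 ka} aE => [|k] aE; first by rewrite /= !mul0r mulr0.
  rewrite [shift1 _ _]/= /ccoef (_ : a - k = p.+1)%N ?addn0; last by lia.
  by rewrite ffactnSr (_ : a - k = p.+1)%N ?PoszM; [ring | lia].
have s4 : p.+1%:Z * p.+2%:Z * (k.-1%:Z * shift2 (ccoef a 0) k) =
    k.-1%:Z * ((a ^_ k)%:Z * dfact p.+2 p.+2).
  case: k {s1 s2 s3 ka} aE => [|[|k]] aE; try by rewrite /= !mul0r mulr0.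
  rewrite [shift2 _ _]/= /ccoef (_ : a - k = p.+2)%N ?addn0; last by lia.
  rewrite !ffactnSr (_ : a - k.+1 = p.+1)%N; last by lia.
  by rewrite (_ : a - k = p.+2)%N ?PoszM; [ring | lia].
have pos : 0 < p.+1%:Z * p.+2%:Z :> int by [].
rewrite -(pmulr_rge0 _ pos).
have -> : p.+1%:Z * p.+2%:Z * (3 * ccoef a.+1 1 k - 2 * ccoef a 3 k -
    k.-1%:Z * shift2 (ccoef a 0) k - k%:Z * shift1 (ccoef a 0) k) =
  3 * p.+2%:Z * (p.+1%:Z * ccoef a.+1 1 k) - 2 * (p.+1%:Z * p.+2%:Z) * ccoef a 3 k -
  p.+1%:Z * p.+2%:Z * (k.-1%:Z * shift2 (ccoef a 0) k) -
  p.+2%:Z * (p.+1%:Z * (k%:Z * shift1 (ccoef a 0) k)) by ring.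
rewrite s1 s2 s3 s4.
have := mulr_ge0 (_ : 0 <= (a ^_ k)%:Z) (tcoef_main_ge0 p k) => /(_ isT).
by congr (_ <= _); ring.
Qed.

(** * Schur expansions *)

(** Different indices may have the same shape, so the coefficients are collected by shape. *)
Lemma schur_positive_sum (I : eqType) (s : seq I) (d : I -> rat) (mu : I -> seq nat)
    (F : powerseries) :
  (forall i, 0 <= d i) -> (forall i, is_partition (mu i)) ->
  (forall m, F m = \sum_(i <- s) d i * schur (mu i) m) -> schur_positive F.
Proof.
move=> d0 mu_part FE.
pose S : {fset seq nat} := [fset x in map mu s]%fset.
pose val x := \sum_(i <- s | mu i == x) d i.
exists [fsfun x in S => val x | 0]; split; last first.
  by move=> x; rewrite fsfunE; case: ifP => // _; apply: sumr_ge0.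
split=> [x|m].
  rewrite mem_finsupp fsfunE; case: ifP => [|_]; last by rewrite eqxx.
  rewrite inE /= => xs _; elim: s xs {FE S val} => //= i s IH.
  by rewrite inE => /orP[/eqP ->|/IH].
rewrite (big_fset_incl _ (finsupp_sub _ _ _)) /= => [|x xS]; last first.
  by rewrite mem_finsupp negbK => /eqP ->; rewrite mul0r.
rewrite FE [RHS]big_seq.
under [RHS]eq_bigr => x xS do rewrite fsfunE xS mulr_suml.
rewrite -[RHS]big_seq [RHS](exchange_big_dep xpredT) //=.
apply: eq_big_seq => i si; rewrite big_mkcond (bigD1_seq (mu i)) ?fset_uniq //=; last first.
  by rewrite inE /= map_f.
rewrite eqxx big1 ?addr0 // => x.
by rewrite eq_sym => /negPf ->.
Qed.

Lemma count_multiplicities (P : pred nat) ms cr : perm_eq cr (undup ms) ->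
  count P [seq count_mem c ms | c <- cr] = class_sum (fun x => P x) ms.
Proof.
move=> pcr; rewrite (permP (perm_map _ pcr)) -sum1_count big_map big_mkcond.
by apply: eq_bigr => c _; case: (P _).
Qed.

Lemma size_class_sum ms : size ms = class_sum id ms.
Proof.
rewrite -(perm_size (perm_count_undup ms)) size_flatten sumnE !big_map.
by apply: eq_bigr => c _; rewrite size_nseq.
Qed.

Lemma class_big0_size ms : class_big ms = 0%N ->
  size ms = (class_count 1 ms + (class_count 2 ms).*2 + 3 * class_count 3 ms)%N.
Proof.
move=> /eqP; rewrite size_class_sum {1}/class_sum sum_nat_seq_eq0 => /allP big0.
rewrite -muln2 /class_sum big_distrl big_distrr -!big_split /=.
apply: eq_big_seq => c cm; have := big0 c cm.
have : (0 < count_mem c ms)%N by rewrite -has_count has_pred1 -mem_undup.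
by case: (count_mem c ms) => [|[|[|[|x]]]].
Qed.

Lemma schur_multiplicities p q u ms : (u <= q <= p)%N ->
  exists M, [/\ schur (shape3 p q u) (content_monomial ms) = (nlattice p q u M)%:R,
    all (leq 1) M, sumn M = size ms, big_part M = class_big ms &
    [/\ count_mem 1%N M = class_count 1 ms, count_mem 2 M = class_count 2 ms
      & count_mem 3 M = class_count 3 ms]].
Proof.
move=> hts; exists [seq count_mem c ms | c <- rev (sort leq (undup ms))].
have pcr : perm_eq (rev (sort leq (undup ms))) (undup ms).
  by rewrite perm_rev perm_sort.
split; rewrite ?schur_shape3 // ?/big_part ?count_multiplicities //.
- apply/allP => _ /mapP[c cm ->]; rewrite -has_count has_pred1 -mem_undup.
  by rewrite -(perm_mem pcr).
- rewrite size_class_sum (perm_sumn (perm_map _ pcr)) sumnE big_map.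
  exact: eq_bigr.
Qed.

Lemma schur_two_columns p q ms : (q <= p)%N ->
  schur (shape3 p q 0) (content_monomial ms) =
  (if [&& p + q == size ms, class_count 3 ms == 0 & class_big ms == 0]%N
   then rcoef (class_count 2 ms) (class_count 1 ms) q else 0)%:~R.
Proof.
move=> qp; have [|M [-> M1 <- <- [<- <- <-]]] := @schur_multiplicities p q 0 ms.
  by rewrite leq0n.
by rewrite pmulrn nlattice0 // qp.
Qed.

Lemma schur_three_columns p q ms : (q < p)%N ->
  schur (shape3 p q.+1 1) (content_monomial ms) =
  (if (p + q.+2 == size ms)%N && (class_big ms == 0%N)
   then vcoef p (class_count 2 ms) (class_count 1 ms) (class_count 3 ms) q else 0)%:~R.
Proof.
move=> qp; have [|M [-> M1 <- <- [<- <- <-]]] := @schur_multiplicities p q.+1 1 ms.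
  by [].
by rewrite pmulrn nlattice1 // qp.
Qed.

Lemma schur_positive_ones_twos a b :
  graph_schur_positive (@multipartite (nseq a 2 ++ nseq b 1)).
Proof.
pose n := (a.*2 + b)%N.
apply: (@schur_positive_sum _ (iota 0 a.+1) (fun k => (ccoef a b k)%:~R)
          (fun k => shape3 (n - k) k 0)) => [k|k|m].
- by rewrite ler0z ccoef_ge0.
- exact: shape3_partition.
have [ms ->] := content_monomial_surj m.
rewrite chromatic_multipartite size_colorings_ones_twos pmulrn /profile_fun.
rewrite (eq_big_seq (fun k => (ccoef a b k *
   (if [&& n == size ms, class_count 3 ms == 0 & class_big ms == 0]%N
    then rcoef (class_count 2 ms) (class_count 1 ms) k else 0))%:~R)); last first.
  move=> k; rewrite mem_iota add0n => /= ka; rewrite schur_two_columns; last by lia.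
  by rewrite subnK ?intrM //; lia.
rewrite -rmorph_sum -[iota _ _]/(index_iota 0 a.+1) big_mkord; congr (_%:~R).
rewrite /count_ones_twos.
case: (class_count 3 ms =P 0%N) => [n3|_]; last first.
  by rewrite !andbF mul0n big1 // => k _; rewrite mulr0.
case: (class_big ms =P 0%N) => [n4|_]; last first.
  by rewrite !andbF mul0n big1 // => k _; rewrite mulr0.
rewrite (class_big0_size n4) n3 muln0 addn0 !andbT eq_sym -/n.
case: (n =P _) => [E|_]; last by rewrite mul0n big1 // => k _; rewrite mulr0.
by rewrite mul1n (@sum_ccoef a b) // addnC -E.
Qed.

Lemma schur_positive_three_twos a :
  graph_schur_positive (@multipartite (3 :: nseq a 2)).
Proof.
pose n := (a.*2 + 3)%N.
(* Non-negativity is required at every index, while [tcoef_ge0] covers [k <= a + 1]; hence the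
   guard, which the listed indices satisfy. *)
apply: (@schur_positive_sum _
  ([seq inl k | k <- iota 0 a.+2] ++ [seq inr q | q <- iota 0 a.+1] : seq (nat + nat))
  (fun i => match i with
            | inl k => if (k <= a.+1)%N then (tcoef a k)%:~R else 0
            | inr q => (ccoef a 0 q)%:~R end)
  (fun i => match i with
            | inl k => shape3 (n - k) k 0
            | inr q => shape3 (a.*2.+1 - q) q.+1 1 end)) => [[k|q]|[k|q]|m].
- by case: leqP => // ka; rewrite ler0z tcoef_ge0.
- by rewrite ler0z ccoef_ge0.
- exact: shape3_partition.
- exact: shape3_partition.
have [ms ->] := content_monomial_surj m.
rewrite chromatic_multipartite size_colorings_three_twos pmulrn.
rewrite big_cat !big_map.
rewrite (eq_big_seq (fun k => (tcoef a k *
   (if [&& n == size ms, class_count 3 ms == 0 & class_big ms == 0]%N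
    then rcoef (class_count 2 ms) (class_count 1 ms) k else 0))%:~R)); last first.
  move=> k; rewrite mem_iota add0n => /= ka; rewrite schur_two_columns; last by rewrite /n; lia.
  by rewrite -ltnS ka subnK ?intrM // /n; lia.
rewrite [X in _ = _ + X](eq_big_seq (fun q => (ccoef a 0 q *
   (if (n == size ms)%N && (class_big ms == 0%N)
    then vcoef (a.*2.+1 - q) (class_count 2 ms) (class_count 1 ms) (class_count 3 ms) q
    else 0))%:~R)); last first.
  move=> q; rewrite mem_iota add0n => /= qa; rewrite schur_three_columns; last by lia.
  by rewrite (_ : a.*2.+1 - q + q.+2 = n)%N ?intrM // /n; lia.
rewrite -!rmorph_sum -[iota 0 a.+2]/(index_iota 0 a.+2) -[iota 0 a.+1]/(index_iota 0 a.+1).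
rewrite !big_mkord -intrD; congr (_%:~R).
case: (class_big ms =P 0%N) => [n4|_]; last first.
  by rewrite mul0n !big1 ?addr0 // => k _; rewrite !andbF mulr0.
rewrite (class_big0_size n4) mul1n !andbT.
set n1 := class_count 1 ms; set n2 := class_count 2 ms.
case: (class_count 3 ms) => [|[|n3]].
- rewrite muln0 addn0 andbT (eq_sym n) -/n.
  case: (_ =P n) => [E|_]; last first.
    by rewrite mul0n !big1 ?addr0 // => k _; rewrite mulr0.
  rewrite sum_tcoef; last by rewrite addnC E.
  (* By Pascal's rule [3 'C(a + 1, j) - 2 'C(a, j)] is ['C(a, j) + 3 'C(a, j - 1)]; this is the
     origin of the constants 3 and 2 in [tcoef]. *)
  rewrite mul1n; case: n2 {E} => [|n2].
    by rewrite /= !bin0; lia.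
  by rewrite binS /=; lia.
(* One class of size 3: the two-column terms vanish, and what remains is the identity for
   [K_(2^a)]. *)
- rewrite muln1 (eq_sym n) eqn_add2r andbF.
  rewrite [X in _ = X + _]big1 ?add0r => [|k _]; last by rewrite mulr0.
  case: (_ =P a.*2) => [E|_]; last by rewrite mul0n big1 // => k _; rewrite mulr0.
  by rewrite mul1n -(@sum_ccoef a 0) // addnC E addn0.
rewrite andbF [X in _ = X + _]big1 ?add0r => [|k _]; last by rewrite mulr0.
by rewrite big1 // => k _; case: ifP => _; rewrite /vcoef mulr0.
Qed.

Theorem theorem4p18 (lam : seq nat) (hlam : is_partition lam)
    (hk : (2 <= size lam)%N) :
  graph_schur_positive (@multipartite lam) <->
    (forall x : nat, x \in lam -> x = 1%N \/ x = 2%N) \/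
    (exists beta : nat, (1 <= beta)%N /\ lam = 3%N :: nseq beta 2%N).
Proof.
split=> [|[lam12|[beta [_ ->]]]]; first exact: schur_positive_parts.
  suff [a [b ->]] : exists a b, lam = nseq a 2%N ++ nseq b 1%N.
    exact: schur_positive_ones_twos.
  case/andP: hlam => slam _; elim: lam slam lam12 {hk} => [|x lam IH] slam lam12.
    by exists 0%N, 0%N.
  have geq_trans : transitive geq by move=> u v w /= uv vw; exact: leq_trans vw uv.
  move: slam; rewrite /= (path_sortedE geq_trans) => /andP[/allP xmax slam].
  have [|a [b E]] := IH slam; first by move=> y yl; apply: lam12; rewrite inE yl orbT.
  have [x1|x2] := lam12 x (mem_head _ _); last by exists a.+1, b; rewrite E x2.
  (* A part 1 at the head of a decreasing list excludes any 2 behind it. *)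
  exists 0%N, b.+1; rewrite E x1; case: a E => [|a] // E.
  by have := xmax 2%N; rewrite E inE eqxx x1 => /(_ isT).
exact: schur_positive_three_twos.
Qed.
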